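(* Let $n\geq 1$, let $H$ be any graph, and let $S=K[V(K_n\odot H)]$. Then (a) $\operatorname{depth}(S/I(K_n\odot H))=1+(n-1)\big(\operatorname{depth}(K[V(H)]/I(H))+|i(H)|\big)$; (b) $\operatorname{sdepth}(S/I(K_n\odot H))\geq 1+(n-1)\big(\operatorname{sdepth}(K[V(H)]/I(H))+|i(H)|\big)$. In particular, if $H$ is a null graph, then $\operatorname{sdepth}(S/I(K_n\odot H))=1+(n-1)|V(H)|$.
   Context: $K$ is a field. All graphs are finite, simple, have nonempty vertex set, and may have isolated vertices. Vertices of a graph $G$ are identified with the variables of the standard graded polynomial ring $K[V(G)]$. A null graph is a graph with no edges. $i(H)$ denotes the set of isolated vertices of $H$. Edge ideal convention: $I(G)\subset K[V(G)]$ is the ideal generated by all products $x_ix_j$ with $\{x_i,x_j\}\in E(G)$ together with all variables $x_k$ with $x_k$ an isolated vertex of $G$. Thus $K[V(H)]/I(H)\cong K[V(H')]/I(H')$, where $H'$ is the induced subgraph of $H$ on the non-isolated vertices, and if $H$ is null then $K[V(H)]/I(H)\cong K$ with depth and Stanley depth $0$. The corona product $X\odot H$ is the graph obtained from one copy of $X$ and $|V(X)|$ disjoint copies of $H$, namely $H_1,\dots,H_{|V(X)|}$, by joining the $i$-th vertex of $X$ to every vertex of $H_i$. It has no isolated vertices, so $I(X\odot H)$ is the usual edge ideal. $K_n$ is the complete graph on $n$ vertices ($K_1$ is a single vertex). $\operatorname{depth}$ is taken with respect to the graded maximal ideal. For a finitely generated $\mathbb{Z}^r$-graded module $A$ over a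 polynomial ring $R$ in $r$ variables over $K$, a Stanley decomposition is a finite direct sum of $K$-vector spaces $A=\bigoplus_{i} a_iK[X_i]$ with $a_i\in A$ homogeneous, $X_i$ a subset of the variables, and $a_iK[X_i]$ (the $K$-span of all $a_it$, $t$ a monomial in $K[X_i]$) a free $K[X_i]$-module; its Stanley depth is $\min_i|X_i|$, and $\operatorname{sdepth}(A)$ is the maximum over all Stanley decompositions of $A$. *)

(* Defs.v *)
From HB Require Import structures.
From mathcomp Require Import all_boot all_order all_algebra.
From mathcomp Require Import generic_quotient ring_quotient.
From mathcomp Require Import mpoly.
From mathcomp Require Import boolp.

Set Implicit Arguments.
Unset Strict Implicit.
Unset Printing Implicit Defensive.

Import GRing.Theory.
Local Open Scope ring_scope.
Local Open Scope quotient_scope.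

(* The value 0 is used when [P] has no maximum; it never matters below, since
   regular sequences and Stanley decompositions of a nonzero finitely generated
   graded module exist, and their lengths, resp. Stanley depths, are bounded by
   the number of variables. *)
Definition nat_max (P : nat -> Prop) : nat :=
  if pselect (exists m, P m /\ forall k, P k -> (k <= m)%N) is left h
  then projT1 (cid h) else 0%N.

Section Quotient.
Variable R : comNzRingType.

Definition in_ideal_gen (G : R -> Prop) (f : R) : Prop :=
  exists s : seq (R * R),
    (forall u, u \in s -> G u.2) /\ f = \sum_(u <- s) u.1 * u.2.

Definition ideal_gen (G : R -> Prop) : R -> bool := fun f => `[< in_ideal_gen G f >].

Lemma ideal_gen_mull (G : R -> Prop) a f : f \in ideal_gen G -> a * f \in ideal_gen G.
Proof.
move=> /asboolP [s [sG ->]]; apply/asboolP.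
exists [seq (a * u.1, u.2) | u <- s]; split.
  by move=> _ /mapP [u us ->]; exact: sG us.
by rewrite big_map mulr_sumr; apply: eq_bigr => u _; rewrite mulrA.
Qed.

Lemma ideal_gen_zmod_closed (G : R -> Prop) : zmod_closed (ideal_gen G).
Proof.
split=> [|f g If /(ideal_gen_mull (-1))].
  by apply/asboolP; exists [::]; rewrite big_nil.
rewrite mulN1r; move: If => /asboolP [s [sG ->]] /asboolP [t [tG ->]].
apply/asboolP; exists (s ++ t); split; last by rewrite big_cat.
by move=> u; rewrite mem_cat => /orP [/sG|/tG].
Qed.

HB.instance Definition _ (G : R -> Prop) :=
  GRing.isZmodClosed.Build R (ideal_gen G) (ideal_gen_zmod_closed G).

Definition ideal_gen_zmod (G : R -> Prop) : zmodClosed R :=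
  GRing.ZmodClosed.clone R (ideal_gen G) _.

(* The quotient module R/(G). *)
Definition quot_gen (G : R -> Prop) : Type := {ideal_quot (ideal_gen_zmod G)}.

HB.instance Definition _ (G : R -> Prop) := GRing.Zmodule.on (quot_gen G).

Definition proj (G : R -> Prop) (f : R) : quot_gen G := \pi_{ideal_quot (ideal_gen_zmod G)} f.

Definition quot_scale (G : R -> Prop) (a : R) (x : quot_gen G) : quot_gen G :=
  proj G (a * repr (x : {ideal_quot (ideal_gen_zmod G)})).

Lemma projB (G : R -> Prop) : {morph proj G : f g / f - g}.
Proof. by move=> f g; rewrite /proj !piE. Qed.

Lemma projD (G : R -> Prop) : {morph proj G : f g / f + g}.
Proof. by move=> f g; rewrite /proj !piE. Qed.

Lemma proj_eq (G : R -> Prop) f g : proj G f = proj G g <-> f - g \in ideal_gen G.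
Proof.
rewrite -[f - g \in _]/(f - g \in ideal_gen_zmod G) Quotient.idealrBE.
by split=> /eqP.
Qed.

Lemma proj_repr (G : R -> Prop) (x : quot_gen G) :
  proj G (repr (x : {ideal_quot (ideal_gen_zmod G)})) = x.
Proof. exact: reprK. Qed.

Lemma quot_scale_proj (G : R -> Prop) a f : quot_scale a (proj G f) = proj G (a * f).
Proof.
apply/proj_eq; rewrite -mulrBr; apply: ideal_gen_mull.
by apply/proj_eq; rewrite proj_repr.
Qed.

Fact quot_scaleA (G : R -> Prop) a b (x : quot_gen G) :
  quot_scale a (quot_scale b x) = quot_scale (a * b) x.
Proof. by rewrite -[x]proj_repr !quot_scale_proj mulrA. Qed.

Fact quot_scale1 (G : R -> Prop) : left_id 1 (@quot_scale G).
Proof. by move=> x; rewrite -[x]proj_repr !quot_scale_proj mul1r. Qed.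

Fact quot_scaleDr (G : R -> Prop) : right_distributive (@quot_scale G) +%R.
Proof.
move=> a x y; rewrite -[x]proj_repr -[y]proj_repr -projD !quot_scale_proj.
by rewrite mulrDr projD.
Qed.

Fact quot_scaleDl (G : R -> Prop) (x : quot_gen G) :
  {morph (@quot_scale G)^~ x : a b / a + b}.
Proof.
by move=> a b; rewrite -[x]proj_repr !quot_scale_proj mulrDl projD.
Qed.

HB.instance Definition _ (G : R -> Prop) :=
  GRing.Zmodule_isLmodule.Build R (quot_gen G)
    (@quot_scaleA G) (@quot_scale1 G) (@quot_scaleDr G) (@quot_scaleDl G).

End Quotient.

Section Depth.
Variables (R : comNzRingType) (M : lmodType R).

(* Membership in the submodule (f_1, ..., f_k) M. *)
Definition in_seq_mul (s : seq R) (x : M) : Prop :=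
  exists y : 'I_(size s) -> M, x = \sum_(i < size s) s`_i *: y i.

Definition regular_seq (s : seq R) : Prop :=
  (forall i, (i < size s)%N -> forall x : M,
     in_seq_mul (take i s) (s`_i *: x) -> in_seq_mul (take i s) x)
  /\ exists x : M, ~ in_seq_mul s x.

Definition depth_wrt (m : R -> Prop) : nat :=
  nat_max (fun k => exists s : seq R,
    [/\ size s = k, forall f, f \in s -> m f & regular_seq s]).

End Depth.

Section Graded.
Variables (K : fieldType) (r : nat).
Local Notation S := {mpoly K[r]}.

Definition max_ideal (f : S) : Prop := f@_0%MM = 0.

Definition depth (M : lmodType S) : nat := depth_wrt M max_ideal.

(* p lies in the polynomial subring K[X]. *)
Definition poly_in (X : {set 'I_r}) (p : S) : Prop :=
  forall m, m \in msupp p -> forall i, m i != 0%N -> i \in X.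

Section StanleyDepth.
Variables (A : lmodType S) (gr : ('I_r -> int) -> A -> Prop).

(* [gr d] is the homogeneous component of A of degree d.  The second clause is
   freeness of each a_i K[X_i]; the last two say that A is the internal direct
   sum of the subspaces a_i K[X_i]. *)
Definition stanley_decomposition (k : nat)
    (a : 'I_k -> A) (X : 'I_k -> {set 'I_r}) : Prop :=
  [/\ forall i, exists d, gr d (a i),
      forall i p, poly_in (X i) p -> p *: a i = 0 -> p = 0,
      forall x : A, exists p : 'I_k -> S,
        (forall i, poly_in (X i) (p i)) /\ x = \sum_(i < k) p i *: a i
    & forall p : 'I_k -> S, (forall i, poly_in (X i) (p i)) ->
        \sum_(i < k) p i *: a i = 0 -> forall i, p i *: a i = 0].

Definition sdepth_of_decomposition (k : nat) (X : 'I_k -> {set 'I_r}) (d : nat) : Prop :=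
  (exists i, #|X i| = d) /\ forall i, (d <= #|X i|)%N.

Definition sdepth_graded : nat :=
  nat_max (fun d => exists (k : nat) (a : 'I_k -> A) (X : 'I_k -> {set 'I_r}),
    stanley_decomposition a X /\ sdepth_of_decomposition X d).

End StanleyDepth.

(* The degree d component of S/(G), for G a set of monomials: the image of the
   degree d component of S, where S has its standard Z^r-grading. *)
Definition quot_component (G : S -> Prop) (d : 'I_r -> int) (x : quot_gen G) : Prop :=
  exists f : S,
    (forall m, m \in msupp f -> forall i, (m i)%:Z = d i) /\ x = proj G f.

Definition sdepth (G : S -> Prop) : nat := sdepth_graded (@quot_component G).

End Graded.

Record sgraph := SGraph {
  vertex :> finType;
  edge : rel vertex;
  edge_sym : ssrbool.symmetric edge;
  edge_irr : irreflexive edge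
}.

Definition null_graph (G : sgraph) : Prop := forall x y : G, ~~ edge x y.

Definition isolated (G : sgraph) : {set G} := [set x | [forall y, ~~ edge x y]].

Section Complete.
Variable n : nat.

Definition complete_rel : rel 'I_n := fun x y => x != y.

Fact complete_sym : ssrbool.symmetric complete_rel.
Proof. by move=> x y; rewrite /complete_rel eq_sym. Qed.

Fact complete_irr : irreflexive complete_rel.
Proof. by move=> x; rewrite /complete_rel eqxx. Qed.

Definition complete : sgraph := SGraph complete_sym complete_irr.

End Complete.

Section Corona.
Variables X H : sgraph.

(* [inr (x, h)] is the vertex h of the copy of H attached to x. *)
Definition corona_rel : rel (X + X * H)%type := fun u v =>
  match u, v with
  | inl x, inl y => edge x y
  | inl x, inr (y, _) => x == y
  | inr (x, _), inl y => x == y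
  | inr (x, h), inr (y, k) => (x == y) && edge h k
  end.

Fact corona_sym : ssrbool.symmetric corona_rel.
Proof.
case=> [x|[x h]] [y|[y k]] //=; rewrite ?(eq_sym x y) // edge_sym //.
Qed.

Fact corona_irr : irreflexive corona_rel.
Proof. by case=> [x|[x h]] /=; rewrite edge_irr ?andbF. Qed.

Definition corona : sgraph := SGraph corona_sym corona_irr.

End Corona.

Section EdgeIdeal.
Variables (K : fieldType) (G : sgraph).

Definition var (x : G) : {mpoly K[#|G|]} := 'X_(enum_rank x).

(* Generators of the edge ideal; isolated vertices contribute their variable. *)
Definition edge_gens (f : {mpoly K[#|G|]}) : Prop :=
  (exists x y : G, edge x y /\ f = var x * var y)
  \/ (exists x : G, x \in isolated G /\ f = var x).

Definition edge_quot : lmodType {mpoly K[#|G|]} := quot_gen edge_gens.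

Definition edge_depth : nat := depth edge_quot.

Definition edge_sdepth : nat := sdepth edge_gens.

End EdgeIdeal.

(* Main.v *)
From HB Require Import structures.
Require Import Defs.
From mathcomp Require Import all_boot all_order all_algebra.
From mathcomp Require Import mpoly ring.
From mathcomp Require Import boolp.

Set Implicit Arguments.
Unset Strict Implicit.
Unset Printing Implicit Defensive.

Import Order.TTheory GRing.Theory.

(** Put t := depth (K[V(H)]/I(H)) + |i(H)|.  As I(H) contains the isolated
    vertices, t is the depth of the quotient of K[V(H)] by the plain edge ideal,
    the one generated by the edges alone.  Also t >= 1: a squarefree monomial
    ideal containing no variable has no socle in its quotient, unless the ring
    has no variables ([plain_depth_gt0]).

    Depth.  Call the vertices of K_n hubs and the other vertices of the corona
    leaves, and let J_k be the edge ideal of the corona enlarged by the first k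
    hubs.  For the next hub x there is an exact sequence
      0 -> S/(J_k : x) -> S/J_k -> S/J_(k+1) -> 0.
    The last quotient S/J_n is a tensor product of n copies of the plain quotient
    of H, hence of depth n t.  The ideal (J_k : x) does not depend on the
    smaller hubs: it contains the other hubs and the leaves at x, so its quotient
    is K[x] tensored with n - 1 copies, of depth d := 1 + (n - 1) t <= n t
    ([first_hubs_colon], [exact_depth_all_colon]).  By descending induction on k
    the depth lemma gives depth (S/J_k) >= d, and for k = 0 it forbids a larger
    value since the left-hand term has depth exactly d ([corona_depth]).

    The depth lemma is proved for the vanishing range of Koszul cohomology
    ([depth_ge_middle], [depth_ge_left], [depth_ge_right]).  This range is
    the maximal length of a regular sequence: elements of the irrelevant ideal act
    by null-homotopic maps ([kos_homotopy]), so regular sequences force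
    vanishing; conversely, vanishing in degree 0 says that the socle is zero, and
    then the irrelevant ideal contains a regular element because chains of ideals
    are stationary ([regular_element_of_socle_free]).  The depth of a
    tensor product over K is additive because a regular sequence that cannot
    be prolonged, together with an element of the socle modulo it, can be
    concatenated with another one in disjoint variables ([exact_depth_union]).

    Stanley depth.  Stanley decompositions of a quotient by a monomial ideal
    amount to partitions of its standard monomials into cones u K[X]
    ([std_family_of_decomposition], [decomposition_of_std_family]).  A standard
    monomial of the corona involves at most one hub; if it involves the hub x then
    it involves no leaf at x, and on the leaves at every other hub it is an
    arbitrary standard monomial of the plain edge ideal.  So products of cones of
    a partition for H give a partition for the corona, with cones of dimension at
    least 1 + (n - 1) t' or n t' if those for H have dimension at least t'
    ([product_partition], [card_product_cone]); here t' >= 1 can be arranged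
    by sorting the monomials by support ([ex_plain_partition]).  The
    upper bound 1 + (n - 1) |V(H)| comes from the cone that contains a hub x: its
    free variables are among x and the leaves at the other hubs
    ([corona_sdepth_le]). *)

(** * Ideals of a commutative ring and regular sequences modulo an ideal *)

Section Ideals.
Variable R : comNzRingType.
Local Open Scope ring_scope.
Implicit Types (J G : R -> Prop) (f g : R).

Definition is_ideal J :=
  [/\ J 0, forall f g, J f -> J g -> J (f + g) & forall a f, J f -> J (a * f)].

Section IdealTheory.
Variables (J : R -> Prop) (hJ : is_ideal J).

Lemma ideal0 : J 0. Proof. by case: hJ. Qed.
Lemma idealD f g : J f -> J g -> J (f + g). Proof. by case: hJ => _ h _; exact: h. Qed.
Lemma idealM a f : J f -> J (a * f). Proof. by case: hJ => _ _; exact. Qed.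
Lemma ideal_mulr a f : J f -> J (f * a). Proof. by rewrite mulrC; exact: idealM. Qed.
Lemma idealN f : J f -> J (- f). Proof. by rewrite -mulN1r; exact: idealM. Qed.
Lemma idealB f g : J f -> J g -> J (f - g).
Proof. by move=> jf jg; apply: idealD => //; exact: idealN. Qed.
Lemma ideal_sum (I : Type) (s : seq I) (P : pred I) (F : I -> R) :
  (forall i, P i -> J (F i)) -> J (\sum_(i <- s | P i) F i).
Proof. by move=> jF; apply: big_ind => //; [exact: ideal0 | exact: idealD]. Qed.
Lemma ideal_congr f g : J (f - g) -> J f <-> J g.
Proof.
move=> jfg; split=> jf; last by rewrite -(subrK g f); exact: idealD.
by rewrite -(subrK f g); apply: idealD => //; rewrite -opprB; exact: idealN.
Qed.

End IdealTheory.

Lemma in_ideal_gen_ideal G : is_ideal (in_ideal_gen G).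
Proof.
split=> [|f g /asboolP jf /asboolP jg|a f /asboolP jf]; apply/asboolP.
- exact: (rpred0 (ideal_gen_zmod G)).
- exact: (rpredD (S := ideal_gen_zmod G) jf jg).
- exact: ideal_gen_mull.
Qed.

Lemma in_ideal_gen_mem G f : G f -> in_ideal_gen G f.
Proof.
move=> Gf; exists [:: (1, f)]; split; last by rewrite big_seq1 mul1r.
by move=> u; rewrite inE => /eqP ->.
Qed.

Lemma in_ideal_gen_min G J : is_ideal J -> (forall f, G f -> J f) ->
  forall f, in_ideal_gen G f -> J f.
Proof.
move=> hJ GJ f [s [sG ->]]; rewrite big_seq; apply: ideal_sum => // u us.
by apply: idealM => //; apply/GJ/sG.
Qed.

Lemma in_ideal_gen_eq G G' :
  (forall f, G f -> in_ideal_gen G' f) -> (forall f, G' f -> in_ideal_gen G f) ->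
  in_ideal_gen G = in_ideal_gen G'.
Proof.
move=> h h'; apply/funext => f; apply/propext; split; apply: in_ideal_gen_min => //;
  exact: in_ideal_gen_ideal.
Qed.

Definition adjoin J f : R -> Prop := fun g => exists a, J (g - a * f).

Definition colon J f : R -> Prop := fun g => J (f * g).

Lemma adjoin_ideal J f : is_ideal J -> is_ideal (adjoin J f).
Proof.
move=> hJ; split=> [|g g' [a ja] [b jb]|b g [a ja]].
- by exists 0; rewrite mul0r subrr; exact: ideal0.
- exists (a + b); rewrite mulrDl opprD addrACA; exact: idealD.
- by exists (b * a); rewrite -mulrA -mulrBr; exact: idealM.
Qed.

Lemma adjoin_sub J f g : is_ideal J -> J g -> adjoin J f g.
Proof. by move=> hJ jg; exists 0; rewrite mul0r subr0. Qed.

Lemma adjoin_mem J f : is_ideal J -> adjoin J f f.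
Proof. by move=> hJ; exists 1; rewrite mul1r subrr; exact: ideal0. Qed.

Lemma adjoin_gen G f :
  adjoin (in_ideal_gen G) f = in_ideal_gen (fun g => G g \/ g = f).
Proof.
have hG := in_ideal_gen_ideal G.
apply/funext => g; apply/propext; split.
  case=> a ja; rewrite -(subrK (a * f) g).
  apply: idealD; [exact: in_ideal_gen_ideal| |].
    apply: in_ideal_gen_min ja; first exact: in_ideal_gen_ideal.
    by move=> h Gh; apply: in_ideal_gen_mem; left.
  apply: idealM; first exact: in_ideal_gen_ideal.
  by apply: in_ideal_gen_mem; right.
move: g; apply: in_ideal_gen_min; first exact: adjoin_ideal.
move=> h [Gh|->]; last exact: adjoin_mem.
by apply: adjoin_sub => //; exact: in_ideal_gen_mem.
Qed.

Lemma colon_ideal J f : is_ideal J -> is_ideal (colon J f).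
Proof.
move=> hJ; rewrite /colon; split=> [|g h|a g].
- by rewrite mulr0; exact: ideal0.
- by rewrite mulrDr; exact: idealD.
- by rewrite mulrCA; exact: idealM.
Qed.

Fixpoint adjoins J (s : seq R) : R -> Prop :=
  if s is f :: s' then adjoins (adjoin J f) s' else J.

(** Regularity of s on R/J, without forming quotient modules: only the ideals
    J, J + (s_0), J + (s_0, s_1) and so on appear. *)
Fixpoint regular J (s : seq R) : Prop :=
  if s is f :: s' then (forall g, J (f * g) -> J g) /\ regular (adjoin J f) s'
  else True.

Lemma adjoins_ideal J s : is_ideal J -> is_ideal (adjoins J s).
Proof. by elim: s J => //= f s IHs J hJ; apply/IHs/adjoin_ideal. Qed.

Lemma adjoins_cat J s t : adjoins J (s ++ t) = adjoins (adjoins J s) t.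
Proof. by elim: s J => /=. Qed.

Lemma regular_cat J s t :
  regular J (s ++ t) <-> regular J s /\ regular (adjoins J s) t.
Proof.
elim: s J => [|f s IHs] J /=; first by split=> // -[].
rewrite IHs; tauto.
Qed.

Lemma adjoins_gen G s :
  adjoins (in_ideal_gen G) s = in_ideal_gen (fun g => G g \/ g \in s).
Proof.
elim: s G => [|f s IHs] G /=.
  by congr in_ideal_gen; apply/funext => g; apply/propext; split=> [|[]]; auto.
rewrite adjoin_gen IHs; congr in_ideal_gen; apply/funext => g; apply/propext.
rewrite in_cons; split.
  by case=> [[?|->]|gs]; [left|right; rewrite eqxx|right; rewrite gs orbT].
by case=> [?|/orP [/eqP ->|?]]; [left; left|left; right|right].
Qed.

(** The bridge to submodules s M written out as sums over the entries of s. *)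
Lemma adjoinsE J s g : is_ideal J ->
  adjoins J s g <-> exists c : nat -> R, J (g - \sum_(i < size s) s`_i * c i).
Proof.
elim: s J => [|f s IHs] J hJ /=.
  split=> [jg|[c]]; last by rewrite big_ord0 subr0.
  by exists (fun=> 0); rewrite big_ord0 subr0.
rewrite IHs; last exact: adjoin_ideal.
split=> [[c [a ja]]|[c jc]].
  exists (fun i => if i is j.+1 then c j else a).
  by rewrite big_ord_recl /= opprD addrCA addrC mulrC.
exists (c \o S), (c 0%N).
by move: jc; rewrite big_ord_recl /= opprD addrCA addrC mulrC.
Qed.

End Ideals.

(** * Koszul cohomology and the depth lemma *)

Section Koszul.
Variable R : comNzRingType.
Local Open Scope ring_scope.
Implicit Types (J : R -> Prop) (l : seq R).

(** The Koszul cochain complex of the sequence l, as the exterior algebra: the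
    second component of a pair is the coefficient of the basis vector dual to
    the first entry of l.  Cochains with values in R/J are cochains with
    values in R, compared modulo [kos_in J]. *)
Fixpoint kos l : lmodType R :=
  if l is _ :: l' then (kos l' * kos l')%type : lmodType R else R^o.

Fixpoint kos_d l : kos l -> kos l :=
  match l with
  | [::] => fun=> 0
  | a :: l' => fun z : kos l' * kos l' => (kos_d z.1, a *: z.1 - kos_d z.2)
  end.

Fixpoint kos_deg l (i : nat) : kos l -> Prop :=
  match l with
  | [::] => fun z => (i = 0)%N \/ z = 0
  | _ :: l' => fun z : kos l' * kos l' =>
      kos_deg i z.1 /\ (if i is j.+1 then kos_deg j z.2 else z.2 = 0)
  end.

(** Degree i - 1, with the convention that the complex is zero in degree -1. *)
Definition kos_pdeg l (i : nat) (z : kos l) : Prop :=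
  if i is j.+1 then kos_deg j z else z = 0.

Fixpoint kos_in J l : kos l -> Prop :=
  match l with
  | [::] => fun z => J z
  | _ :: l' => fun z : kos l' * kos l' => kos_in J z.1 /\ kos_in J z.2
  end.

Lemma kos_d_linear l a (u v : kos l) : kos_d (a *: u + v) = a *: kos_d u + kos_d v.
Proof.
elim: l u v => [|b l IHl] u v /=; first by rewrite scaler0 addr0.
congr (_, _); rewrite /= !IHl // scalerDr opprD addrACA scalerBr.
by rewrite !scalerA mulrC.
Qed.

Lemma kos_d0 l : kos_d (0 : kos l) = 0.
Proof.
have := kos_d_linear 1 0 (0 : kos l).
by rewrite !scale1r addr0 => /eqP; rewrite -{1}[kos_d 0]addr0 (inj_eq (addrI _)) => /eqP.
Qed.

Lemma kos_dZ l a (u : kos l) : kos_d (a *: u) = a *: kos_d u.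
Proof. by rewrite -[a *: u]addr0 kos_d_linear kos_d0 addr0. Qed.

Lemma kos_dN l (u : kos l) : kos_d (- u) = - kos_d u.
Proof. by rewrite -scaleN1r kos_dZ scaleN1r. Qed.

Lemma kos_dD l (u v : kos l) : kos_d (u + v) = kos_d u + kos_d v.
Proof. by rewrite -[u]scale1r kos_d_linear !scale1r. Qed.

Lemma kos_dB l (u v : kos l) : kos_d (u - v) = kos_d u - kos_d v.
Proof. by rewrite -scaleN1r kos_dD kos_dZ scaleN1r. Qed.

Lemma kos_dd l (z : kos l) : kos_d (kos_d z) = 0.
Proof.
elim: l z => //= a l IHl z.
by congr (_, _); rewrite /= ?kos_dB ?kos_dZ IHl // subr0 subrr.
Qed.

Lemma kos_deg0 l i : kos_deg i (0 : kos l).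
Proof. by elim: l i => [|a l IHl] [|i] //=; [left|right]. Qed.

Lemma kos_degD l i (u v : kos l) : kos_deg i u -> kos_deg i v -> kos_deg i (u + v).
Proof.
elim: l i u v => [|a l IHl] i u v /=.
  case=> [->|->]; first by left.
  by case=> [->|->]; [left|right; rewrite addr0].
move=> [u1 u2] [v1 v2]; split; first exact: IHl.
by case: i {u1 v1} u2 v2 => [-> ->|i]; [rewrite addr0|exact: IHl].
Qed.

Lemma kos_degZ l i a (u : kos l) : kos_deg i u -> kos_deg i (a *: u).
Proof.
elim: l i u => [|b l IHl] i u /=.
  by case=> [->|->]; [left|right; rewrite scaler0].
move=> [u1 u2]; split; first exact: IHl.
by case: i {u1} u2 => [->|i]; [rewrite scaler0|exact: IHl].
Qed.

Lemma kos_pdegD l i (u v : kos l) : kos_pdeg i u -> kos_pdeg i v -> kos_pdeg i (u + v).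
Proof. by case: i => [-> ->|i]; [exact: addr0|exact: kos_degD]. Qed.

Lemma kos_pdegZ l i a (u : kos l) : kos_pdeg i u -> kos_pdeg i (a *: u).
Proof. by case: i => [->|i]; [exact: scaler0|exact: kos_degZ]. Qed.

Lemma kos_degB l i (u v : kos l) : kos_deg i u -> kos_deg i v -> kos_deg i (u - v).
Proof. by move=> hu hv; apply: kos_degD => //; rewrite -scaleN1r; exact: kos_degZ. Qed.

Lemma kos_deg_d l i (z : kos l) : kos_deg i z -> kos_deg i.+1 (kos_d z).
Proof.
elim: l i z => [|a l IHl] i z /=; first by right.
move=> [z1 z2]; split; first exact: IHl.
apply: kos_degB; first exact: kos_degZ.
by case: i {z1} z2 => [->|i]; [rewrite kos_d0; exact: kos_deg0|exact: IHl].
Qed.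

Section KosIn.
Variables (J : R -> Prop) (hJ : is_ideal J).

Lemma kos_in0 l : kos_in J (0 : kos l).
Proof. by elim: l => [|a l IHl] /=; [exact: ideal0|]. Qed.

Lemma kos_inD l (u v : kos l) : kos_in J u -> kos_in J v -> kos_in J (u + v).
Proof.
elim: l u v => [|a l IHl] u v /=; first exact: idealD.
by move=> [? ?] [? ?]; split; exact: IHl.
Qed.

Lemma kos_inZ l a (u : kos l) : kos_in J u -> kos_in J (a *: u).
Proof.
elim: l u => [|b l IHl] u /=; first exact: idealM.
by move=> [? ?]; split; exact: IHl.
Qed.

Lemma kos_inB l (u v : kos l) : kos_in J u -> kos_in J v -> kos_in J (u - v).
Proof. by move=> hu hv; apply: kos_inD => //; rewrite -scaleN1r; exact: kos_inZ. Qed.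

Lemma kos_in_d l (u : kos l) : kos_in J u -> kos_in J (kos_d u).
Proof.
elim: l u => [|a l IHl] u /=; first by move=> _; exact: ideal0.
move=> [? ?]; split; first exact: IHl.
by apply: kos_inB; [exact: kos_inZ|exact: IHl].
Qed.

Lemma kos_in_colon l f (u : kos l) : kos_in J (f *: u) <-> kos_in (colon J f) u.
Proof. by elim: l u => [|a l IHl] u //=; rewrite !IHl. Qed.

Lemma kos_in_adjoin l f i (z : kos l) : kos_deg i z ->
  kos_in (adjoin J f) z -> exists2 v, kos_deg i v & kos_in J (z - f *: v).
Proof.
elim: l i z => [|a l IHl] i z /=.
  case=> [->|->] [b jb].
    by exists b; [left|rewrite /= [f *: _]mulrC].
  by exists 0; [right|rewrite scaler0 subr0; exact: ideal0].
move=> [z1 z2] [j1 j2]; have [v1 dv1 jv1] := IHl _ _ z1 j1.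
suff [v2 dv2 jv2] : exists2 v2, kos_pdeg i v2 & kos_in J (z.2 - f *: v2).
  by exists (v1, v2).
case: i {z1 dv1} z2 => [->|i z2]; last exact: IHl.
by exists 0 => //; rewrite scaler0 subr0; exact: kos_in0.
Qed.

Lemma kos_in_adjoinZ l f (z : kos l) : kos_in (adjoin J f) (f *: z).
Proof.
elim: l z => [|a l IHl] z /=; last by split; exact: IHl.
by exists z; rewrite [f *: _]mulrC subrr; exact: ideal0.
Qed.

Lemma kos_in_sub l J' (u : kos l) : (forall f, J f -> J' f) -> kos_in J u -> kos_in J' u.
Proof.
move=> JJ'; elim: l u => [|a l IHl] u /=; first exact: JJ'.
by case=> /IHl ? /IHl.
Qed.

End KosIn.

(** Each entry of l is null-homotopic by contraction with its basis vector,
    and the null-homotopic scalars form an ideal. *)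
Lemma kos_homotopy l f : in_ideal_gen (fun x => x \in l) f ->
  exists h : kos l -> kos l,
  [/\ forall a u v, h (a *: u + v) = a *: h u + h v,
      forall z, kos_d (h z) + h (kos_d z) = f *: z,
      forall i z, kos_deg i z -> kos_pdeg i (h z)
    & forall J z, is_ideal J -> kos_in J z -> kos_in J (h z)].
Proof.
move: f; apply: in_ideal_gen_min.
  split=> [|f g [h [h1 h2 h3 h4]] [k [k1 k2 k3 k4]]|b f [h [h1 h2 h3 h4]]].
  - exists (fun=> 0); split=> //.
    + by move=> a u v; rewrite scaler0 addr0.
    + by move=> z; rewrite kos_d0 addr0 scale0r.
    + by move=> [|i] z _ //=; exact: kos_deg0.
    + by move=> J z hJ _; exact: kos_in0.
  - exists (fun z => h z + k z); split.
    + by move=> a u v; rewrite h1 k1 scalerDr addrACA.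
    + by move=> z; rewrite kos_dD addrACA h2 k2 scalerDl.
    + by move=> i z dz; apply: kos_pdegD; auto.
    + by move=> J z hJ jz; apply: kos_inD; auto.
  - exists (fun z => b *: h z); split.
    + by move=> a u v; rewrite h1 scalerDr !scalerA mulrC.
    + by move=> z; rewrite kos_dZ -scalerDr h2 scalerA.
    + by move=> i z dz; apply: kos_pdegZ; auto.
    + by move=> J z hJ jz; apply: kos_inZ; auto.
elim: l => [|a l IHl] f //.
rewrite in_cons => /orP [/eqP ->|/IHl [h [h1 h2 h3 h4]]].
- exists (fun z : kos l * kos l => (z.2, 0)); split.
  + by move=> b u v; congr (_, _); rewrite /= scaler0 addr0.
  + move=> z; congr (_, _); rewrite /=; first by rewrite addrC subrK.
    by rewrite kos_d0 subr0 addr0.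
  + move=> [|i] z [z1 z2] /=; first by rewrite z2.
    by split=> //; case: i {z1 z2} => //= i; exact: kos_deg0.
  + by move=> J z hJ [? ?]; split=> //; exact: kos_in0.
have h0 : h 0 = 0 by have := h1 (-1) 0 0; rewrite scaler0 addr0 scaleN1r addNr.
have hZ b u : h (b *: u) = b *: h u by rewrite -[b *: u]addr0 h1 h0 addr0.
have hB u v : h (u - v) = h u - h v.
  by rewrite addrC -scaleN1r h1 scaleN1r addrC.
exists (fun z : kos l * kos l => (h z.1, - h z.2)); split.
+ by move=> b u v; congr (_, _); rewrite /= h1 // opprD scalerN.
+ move=> z; congr (_, _); rewrite /= ?h2 //.
  by rewrite kos_dN opprK hB hZ opprB addrC addrA subrK addrC h2.
+ move=> i z [z1 z2]; have := h3 _ _ z1; case: i {z1} z2 => [z2 hz|i z2 hz].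
    by rewrite /= hz z2 h0 oppr0.
  split=> //; have := h3 _ _ z2; case: i {hz z2} => [->|i]; first exact: oppr0.
  by rewrite -scaleN1r; exact: kos_degZ.
+ move=> J z hJ [? ?]; split; first exact: h4.
  by rewrite /= -scaleN1r; apply: kos_inZ => //; exact: h4.
Qed.

(** Vanishing of Koszul cohomology of R/J in degrees below k.  When l
    generates the irrelevant ideal of a polynomial ring, this says that R/J
    has depth at least k. *)
Definition depth_ge l J k := forall i (z : kos l), (i < k)%N ->
  kos_deg i z -> kos_in J (kos_d z) ->
  exists2 w : kos l, kos_pdeg i w & kos_in J (z - kos_d w).

Lemma depth_ge_leq l J k k' : (k' <= k)%N -> depth_ge l J k -> depth_ge l J k'.
Proof. by move=> k'k h i z ik'; apply: h; exact: leq_trans k'k. Qed.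

Lemma kos_pdeg_d l i (z : kos l) : kos_pdeg i z -> kos_deg i (kos_d z).
Proof. by case: i => [->|i]; [rewrite kos_d0; exact: kos_deg0|exact: kos_deg_d]. Qed.

Section Colon.
Variables (l : seq R) (J : R -> Prop) (hJ : is_ideal J) (f : R).

(** Exactness in the middle of the long exact sequence of 0 -> R/(J : f) ->
    R/J -> R/(J + (f)) -> 0, the first map being multiplication by f. *)
Lemma depth_ge_middle k :
  depth_ge l (colon J f) k -> depth_ge l (adjoin J f) k -> depth_ge l J k.
Proof.
move=> hA hC i z ik dz jz.
have [|w dw jw] := hC i z ik dz; first by apply: kos_in_sub jz => g; exact: adjoin_sub.
have dzw : kos_deg i (z - kos_d w).
  by apply: kos_degB => //; exact: kos_pdeg_d.
have [v dv jv] := kos_in_adjoin hJ dzw jw.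
have jdv : kos_in (colon J f) (kos_d v).
  apply/kos_in_colon.
  have -> : f *: kos_d v = kos_d z - kos_d (z - kos_d w - f *: v).
    by rewrite !kos_dB kos_dd subr0 kos_dZ opprB addrC subrK.
  by apply: kos_inB => //; exact: kos_in_d.
have [u du ju] := hA i v ik dv jdv.
exists (w + f *: u); first by apply: kos_pdegD => //; exact: kos_pdegZ.
have -> : z - kos_d (w + f *: u) = (z - kos_d w - f *: v) + f *: (v - kos_d u).
  by rewrite kos_dD kos_dZ opprD scalerBr addrA -[RHS]addrA addKr.
by apply: kos_inD => //; exact/kos_in_colon.
Qed.

(** If f z is the coboundary of w modulo J, then w is a cocycle modulo J +
    (f); correcting it by a coboundary makes it a multiple f v, and z is the
    coboundary of v modulo (J : f). *)
Lemma kos_boundary_colon k i (z w : kos l) : (i < k.+1)%N ->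
    depth_ge l (adjoin J f) k -> kos_deg i z -> kos_pdeg i w ->
    kos_in J (f *: z - kos_d w) ->
  exists2 v : kos l, kos_pdeg i v & kos_in (colon J f) (z - kos_d v).
Proof.
move=> ik hC dz dw jw.
have jdw : kos_in (adjoin J f) (kos_d w).
  have -> : kos_d w = f *: z - (f *: z - kos_d w) by rewrite opprB addrC subrK.
  apply: kos_inB; first exact: adjoin_ideal.
    exact: kos_in_adjoinZ.
  by apply: kos_in_sub jw => g; exact: adjoin_sub.
case: i ik dz dw => [|i] ik dz dw.
  exists 0 => //; rewrite kos_d0 subr0; apply/kos_in_colon.
  by move: jw; rewrite (dw : w = 0) kos_d0 subr0.
have [u du ju] := hC i w ik dw jdw.
have dwu : kos_deg i (w - kos_d u).
  by apply: kos_degB => //; exact: kos_pdeg_d.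
have [v dv jv] := kos_in_adjoin hJ dwu ju.
exists v => //; apply/kos_in_colon.
have -> : f *: (z - kos_d v) = (f *: z - kos_d w) + kos_d (w - kos_d u - f *: v).
  by rewrite !kos_dB kos_dd subr0 kos_dZ addrA subrK scalerBr.
by apply: kos_inD => //; exact: kos_in_d.
Qed.

Lemma depth_ge_left k :
  depth_ge l J k.+1 -> depth_ge l (adjoin J f) k -> depth_ge l (colon J f) k.+1.
Proof.
move=> hB hC i z ik dz /kos_in_colon jz.
have [||w dw jw] := hB i (f *: z) ik; first exact: kos_degZ.
  by rewrite kos_dZ.
exact: kos_boundary_colon hC dz dw jw.
Qed.

Lemma depth_ge_right k :
  depth_ge l (colon J f) k.+1 -> depth_ge l J k -> depth_ge l (adjoin J f) k.
Proof.
move=> hA hB i z ik dz jz.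
have [y dy jy] := kos_in_adjoin hJ (kos_deg_d dz) jz.
have jdy : kos_in (colon J f) (kos_d y).
  apply/kos_in_colon.
  have -> : f *: kos_d y = 0 - kos_d (kos_d z - f *: y).
    by rewrite kos_dB kos_dd kos_dZ !sub0r opprK.
  by apply: kos_inB => //; [exact: kos_in0|exact: kos_in_d].
have [v dv jv] := hA i.+1 y ik dy jdy.
have dzv : kos_deg i (z - f *: v) by apply: kos_degB => //; exact: kos_degZ.
have [|w dw jw] := hB i _ ik dzv.
  have -> : kos_d (z - f *: v) = (kos_d z - f *: y) + f *: (y - kos_d v).
    by rewrite kos_dB kos_dZ scalerBr addrA subrK.
  by apply: kos_inD => //; exact/kos_in_colon.
exists w => //.
have -> : z - kos_d w = (z - f *: v - kos_d w) + f *: v by rewrite addrAC subrK.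
apply: kos_inD; first exact: adjoin_ideal.
  by apply: kos_in_sub jw => g; exact: adjoin_sub.
exact: kos_in_adjoinZ.
Qed.

End Colon.

Lemma colon_regular J f : is_ideal J -> (forall g, J (f * g) -> J g) -> colon J f = J.
Proof.
move=> hJ fJ; apply/funext => g; apply/propext; split; first exact: fJ.
exact: idealM.
Qed.

Section RegularSequences.
Variable l : seq R.
Let m := in_ideal_gen (fun x => x \in l).

Lemma depth_ge_adjoin J f k : is_ideal J -> (forall g, J (f * g) -> J g) ->
  depth_ge l J k.+1 -> depth_ge l (adjoin J f) k.
Proof.
move=> hJ fJ h; apply: depth_ge_right => //; last exact: depth_ge_leq h.
by rewrite colon_regular.
Qed.

(** Multiplication by f is injective on R/J and zero on its Koszul cohomology,
    so the connecting map from R/(J + (f)) is onto. *)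
Lemma depth_ge_unadjoin J f k : is_ideal J -> m f -> (forall g, J (f * g) -> J g) ->
  depth_ge l (adjoin J f) k -> depth_ge l J k.+1.
Proof.
move=> hJ mf fJ hk i z ik dz jz.
have [h [_ hd hdeg hin]] := kos_homotopy mf.
have := kos_boundary_colon hJ ik hk dz (hdeg _ _ dz).
rewrite colon_regular //; apply; rewrite -hd addrC addKr; exact: hin.
Qed.

Lemma depth_ge_adjoins J s k : is_ideal J -> regular J s ->
  depth_ge l J (size s + k) -> depth_ge l (adjoins J s) k.
Proof.
elim: s J => //= f s IHs J hJ [fJ rs] h; apply: IHs => //; first exact: adjoin_ideal.
exact: depth_ge_adjoin.
Qed.

Lemma depth_ge_regular J s k : is_ideal J -> (forall f, f \in s -> m f) ->
  regular J s -> depth_ge l (adjoins J s) k -> depth_ge l J (size s + k).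
Proof.
elim: s J => //= f s IHs J hJ ms [fJ rs] h; apply: depth_ge_unadjoin fJ _ => //.
  by apply: ms; rewrite inE eqxx.
by apply: IHs => // [|g gs]; [exact: adjoin_ideal|apply: ms; rewrite inE gs orbT].
Qed.

Fixpoint kos_const l (g : R) : kos l :=
  match l with
  | [::] => g
  | a :: l' => (kos_const l' g, 0 : kos l')
  end.

Lemma kos_deg0P l' (z : kos l') : kos_deg 0 z -> exists g, z = kos_const l' g.
Proof.
elim: l' z => [|a l' IHl] z /=; first by exists z.
case: z => z1 z2 /= [/IHl [g ->] ->].
by exists g.
Qed.

Lemma kos_deg_const l' g : kos_deg 0 (kos_const l' g).
Proof. by elim: l' => [|a l' IHl] //=; left. Qed.

Lemma kos_in_const J l' g : is_ideal J -> kos_in J (kos_const l' g) <-> J g.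
Proof.
move=> hJ; elim: l' => //= a l' IHl; rewrite IHl; split=> [[]//|jg].
by split=> //; exact: kos_in0.
Qed.

Lemma kos_in_d_const J l' g : is_ideal J ->
  kos_in J (kos_d (kos_const l' g)) <-> forall x, x \in l' -> J (x * g).
Proof.
move=> hJ; elim: l' => [|a l' IHl] /=; first by split=> // _; exact: ideal0.
rewrite IHl kos_d0 subr0; split=> [[h1 h2] x|h].
  rewrite in_cons => /orP [/eqP ->|]; last exact: h1.
  by apply/(kos_in_const l' g (colon_ideal a hJ))/kos_in_colon.
split=> [x xl|]; first by apply: h; rewrite inE xl orbT.
apply/kos_in_colon/kos_in_const; first exact: colon_ideal.
by apply: h; rewrite inE eqxx.
Qed.

(** Degree-zero cocycles are the elements of the socle. *)
Lemma depth_ge1 J : is_ideal J ->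
  depth_ge l J 1 <-> forall g, (forall x, x \in l -> J (x * g)) -> J g.
Proof.
move=> hJ; split=> [h g /(kos_in_d_const _ _ hJ) jg|h [|//] z _ /kos_deg0P [g ->]].
  have [//|w dw] := h 0%N _ isT (kos_deg_const l g).
  by rewrite (dw : w = 0) kos_d0 subr0 kos_in_const.
move=> /(kos_in_d_const _ _ hJ)/h jg.
by exists 0 => //; rewrite kos_d0 subr0 kos_in_const.
Qed.

Fixpoint kos_top l' : kos l' -> R :=
  match l' with
  | [::] => fun z => z
  | a :: l' => fun z : kos l' * kos l' => kos_top z.2
  end.

Fixpoint kos_volume l' : kos l' :=
  match l' with
  | [::] => (1 : R)
  | a :: l' => (0 : kos l', kos_volume l')
  end.

Lemma kos_top_linear l' a (u v : kos l') :
  kos_top (a *: u + v) = a * kos_top u + kos_top v.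
Proof. by elim: l' u v => //= b l' IHl u v; exact: IHl. Qed.

Lemma kos_topB l' (u v : kos l') : kos_top (u - v) = kos_top u - kos_top v.
Proof. by rewrite addrC -scaleN1r kos_top_linear mulN1r addrC. Qed.

Lemma kos_topZ l' a (u : kos l') : kos_top (a *: u) = a * kos_top u.
Proof. by have := kos_top_linear a u (u - u); rewrite kos_topB !subrr !addr0. Qed.

Lemma kos_top_d l' (z : kos l') : in_ideal_gen (fun x => x \in l') (kos_top (kos_d z)).
Proof.
have idl (G : R -> Prop) : is_ideal (in_ideal_gen G) := in_ideal_gen_ideal G.
elim: l' z => [|a l' IHl] z /=; first exact: (ideal0 (idl _)).
rewrite kos_topB kos_topZ; apply: idealB => //.
  by apply: ideal_mulr => //; apply: in_ideal_gen_mem; rewrite inE eqxx.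
apply: in_ideal_gen_min (IHl z.2) => // x xl.
by apply: in_ideal_gen_mem; rewrite inE xl orbT.
Qed.

Lemma kos_deg_volume l' : kos_deg (size l') (kos_volume l').
Proof. by elim: l' => [|a l' IHl] /=; [left|split=> //; exact: kos_deg0]. Qed.

Lemma kos_d_volume l' : kos_d (kos_volume l') = 0.
Proof. by elim: l' => //= a l' IHl; rewrite kos_d0 IHl scaler0 subrr. Qed.

Lemma kos_top_volume l' : kos_top (kos_volume l') = 1.
Proof. by elim: l'. Qed.

Lemma kos_in_top J l' (z : kos l') : kos_in J z -> J (kos_top z).
Proof. by elim: l' z => //= a l' IHl z [_ /IHl]. Qed.

(** The class of the volume form in top degree is not a coboundary, since
    coboundaries have top coefficient in the ideal generated by l. *)
Lemma depth_ge_bound J : is_ideal J -> (forall f, J f -> m f) -> ~ m 1 ->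
  ~ depth_ge l J (size l).+1.
Proof.
move=> hJ Jm m1 h; have [|w dw] := h _ _ (ltnSn _) (kos_deg_volume l).
  by rewrite kos_d_volume; exact: kos_in0.
move=> /kos_in_top/Jm; rewrite kos_topB kos_top_volume => mw.
by apply/m1/(ideal_congr (in_ideal_gen_ideal _) mw); exact: kos_top_d.
Qed.

End RegularSequences.
End Koszul.

(** * Dickson's lemma, stationary chains of ideals and regular elements *)

Lemma nondecreasing_subsequence (v : nat -> nat) :
  exists phi : nat -> nat,
    (forall i j, i < j -> phi i < phi j) /\ (forall i j, i <= j -> v (phi i) <= v (phi j)).
Proof.
have [p pP] : {p : nat -> nat & forall N, N <= p N /\ forall i, N <= i -> v (p N) <= v i}.
  apply: (@choice _ _ (fun N i0 => N <= i0 /\ forall i, N <= i -> v i0 <= v i)) => N.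
  have ex : exists m, `[< exists2 i, N <= i & v i = m >].
    by exists (v N); apply/asboolP; exists N.
  case: (ex_minnP ex) => m /asboolP [i0 Ni0 <-] mini; exists i0; split=> // i Ni.
  by apply: mini; apply/asboolP; exists i.
(* The value at p N is least among those from N on. *)
pose phi k := iter k (fun i => p i.+1) (p 0).
have phiS k : phi k.+1 = p (phi k).+1 by [].
have lt_phi i : phi i < phi i.+1 by rewrite phiS; have [] := pP (phi i).+1.
have incr : {homo phi : i j / i < j}.
  by apply: homo_ltn => //; exact: ltn_trans.
exists phi; split; first exact: incr.
apply: (homo_leq (f := v \o phi) (r := leq)) => //; first exact: leq_trans.
case=> [|i] /=; last first.
  by have [_] := pP (phi i).+1; rewrite -phiS; apply; exact: ltn_trans (lt_phi _) (lt_phi _).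
by have [_] := pP 0; apply.
Qed.

Lemma dickson n (u : nat -> 'X_{1..n}) : exists i j, i < j /\ (u i <= u j)%MM.
Proof.
suff H k : exists phi : nat -> nat, (forall i j, i < j -> phi i < phi j) /\
    forall i j (c : 'I_n), c < k -> i <= j -> u (phi i) c <= u (phi j) c.
  have [phi [incr mono]] := H n; exists (phi 0), (phi 1); split; first exact: incr.
  by apply/mnm_lepP => c; exact: mono.
elim: k => [|k [phi [incr mono]]]; first by exists id; split.
have [kn|nk] := ltnP k n; last first.
  by exists phi; split=> // i j c _; apply: mono; exact: leq_trans (ltn_ord c) nk.
have [psi [incr' mono']] := nondecreasing_subsequence (fun i => u (phi i) (Ordinal kn)).
exists (phi \o psi); split=> [i j ij|i j c]; first exact/incr/incr'.
rewrite ltnS leq_eqVlt => /orP [/eqP ck|ck] ij /=; last first.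
  apply: mono => //; move: ij; rewrite leq_eqVlt => /orP [/eqP -> //|/incr'].
  exact: ltnW.
by rewrite (_ : c = Ordinal kn); [exact: mono'|exact: val_inj].
Qed.

Section Noetherian.
Variables (K : fieldType) (r : nat).
Local Notation S := {mpoly K[r]}.
Local Open Scope ring_scope.

Lemma lead_reduction (f g : S) : f != 0 -> (mlead g <= mlead f)%MM -> g != 0 ->
  exists a, f - a * g = 0 \/ (mlead (f - a * g)%R < mlead f)%O.
Proof.
move=> f0 gf g0.
have cg0 : mleadc g != 0 by rewrite mleadc_eq0.
have c0 : mleadc f / mleadc g != 0 by rewrite mulf_neq0 ?invr_eq0 ?mleadc_eq0.
set d := (mlead f - mlead g)%MM.
have leadX : mleadc ('X_[d] : S) * mleadc g = mleadc g.
  by rewrite mleadXm mcoeffX eqxx mul1r.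
have leadM : mlead ('X_[d] * g) = mlead f.
  by rewrite mleadM_proper ?leadX // mleadXm submK.
have leadcM : mleadc ('X_[d] * g) = mleadc g by rewrite mleadcM_proper ?leadX.
exists ((mleadc f / mleadc g) *: 'X_[d]); rewrite -scalerAl.
set h := f - _; have [->|h0] := eqVneq h 0; [by left|right].
have lg : mlead ((mleadc f / mleadc g) *: ('X_[d] * g)) = mlead f.
  rewrite mleadZ_proper ?leadM //; move: leadcM; rewrite leadM => ->; exact: mulf_neq0.
have hf : h@_(mlead f) = 0.
  by move: leadcM; rewrite leadM mcoeffB mcoeffZ => ->; rewrite divfK ?subrr.
rewrite lt_neqAle; apply/andP; split.
  by apply: contra_neq h0 => e; apply/eqP; rewrite -mleadc_eq0 e hf.
by apply: le_trans (mleadB_le _ _) _; rewrite lg joinxx.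
Qed.

(** If the chain increased strictly at every step, pick in each step a new
    element of least leading monomial.  By Dickson's lemma one of these
    leading monomials divides a later one, and the reduction of the later
    element is a new element with a smaller leading monomial. *)
Lemma ideal_chain_stationary (J : nat -> S -> Prop) :
    (forall k, is_ideal (J k)) -> (forall k f, J k f -> J k.+1 f) ->
  exists k, forall f, J k.+1 f -> J k f.
Proof.
move=> hJ sJ; apply: contrapT => nk.
have [g gP] : {g : nat -> S & forall k, [/\ J k.+1 (g k), ~ J k (g k) &
    forall h, J k.+1 h -> ~ J k h -> ~ (mlead h < mlead (g k))%O]}.
  apply: (@choice _ _ (fun k g => [/\ J k.+1 g, ~ J k g &
    forall h, J k.+1 h -> ~ J k h -> ~ (mlead h < mlead g)%O])) => k.
  have [f [f1 f2]] : exists f, J k.+1 f /\ ~ J k f.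
    apply: contrapT => nf; apply: nk; exists k => f jf.
    by apply: contrapT => njf; apply: nf; exists f.
  elim/(well_founded_ind (@ltom_wf r)): {f}(mlead f) {-2}f (erefl (mlead f)) f1 f2.
  move=> m IH f fm f1 f2.
  have [[h [h1 h2 hf]]|nh] := pselect (exists h, [/\ J k.+1 h, ~ J k h & (mlead h < mlead f)%O]).
    by apply: (IH (mlead h)) h1 h2; rewrite -?fm.
  by exists f; split=> // h h1 h2 hf; apply: nh; exists h.
(* The i-th element lies in the j-th ideal, so reducing by it keeps the j-th element new. *)
have [i [j [ij le]]] := dickson (fun k => mlead (g k)).
have jgi : J j (g i).
  have [+ _ _] := gP i; elim: j ij {le} => // j IHj; rewrite ltnS leq_eqVlt.
  by case/orP => [/eqP ->//|/IHj h /h]; exact: sJ.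
have [g1 g2 g3] := gP j.
have nz k : g k != 0.
  by apply/eqP => gk0; have [_ + _] := gP k; rewrite gk0; apply; exact: ideal0.
have [a ha] := lead_reduction (nz j) le (nz i).
have jh : ~ J j (g j - a * g i).
  by move=> h1; have [_ h] := ideal_congr (hJ j) h1; apply/g2/h; exact: idealM.
case: ha => ha; first by apply: jh; rewrite ha; exact: ideal0.
apply: g3 jh ha; apply: idealB => //; apply: idealM => //; exact: sJ.
Qed.

Section Avoidance.
Variables (J : S -> Prop) (hJ : is_ideal J).

Implicit Types a b u v w f g G h : S.

Let ann_sub u v := forall a, J (a * u) -> J (a * v).

Let max_ann u := ~ J u /\ forall v, ~ J v -> ann_sub u v -> ann_sub v u.

(** Otherwise annihilators of classes modulo J would increase strictly for
    ever. *)
Lemma maximal_annihilator u : ~ J u -> exists2 v, max_ann v & ann_sub u v.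
Proof.
move=> ju; apply: contrapT => nv.
pose P v := ~ J v /\ ann_sub u v.
have [next nextP] : {next : S -> S & forall v, P v ->
    [/\ P (next v), ann_sub v (next v) & ~ ann_sub (next v) v]}.
  apply: (@choice _ _ (fun v w => P v -> [/\ P w, ann_sub v w & ~ ann_sub w v])) => v.
  have [[jv uv]|nP] := pselect (P v); last by exists v.
  apply: contrapT => nw; apply: nv; exists v => //; split=> // w jw vw.
  apply: contrapT => nwv; apply: nw; exists w => _; split=> //; split=> // a /uv.
  exact: vw.
pose w k := iter k next u.
have Pw k : P (w k) by elim: k => [|k /nextP []//]; split.
have [k|k a|k hk] := @ideal_chain_stationary (fun k => colon J (w k)).
- exact: colon_ideal.
- by have [_ h _] := nextP _ (Pw k); rewrite /colon mulrC => /h; rewrite mulrC.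
- have [_ _ []] := nextP _ (Pw k).
  by move=> a h; have := hk a; rewrite /colon mulrC (mulrC _ a); apply.
Qed.

Lemma max_ann_prime u a b : max_ann u -> J (a * (b * u)) -> ~ J (b * u) -> J (a * u).
Proof.
move=> [ju maxu] jabu jbu; apply: maxu jbu _ _ jabu => c jcu.
by rewrite mulrCA; exact: idealM.
Qed.

(** Prime avoidance carried out greedily.  A state consists of representatives
    u of finitely many maximal annihilators (J : u), which are prime, and of
    an element f of m outside all of them.  If f is a zero divisor modulo J,
    it lies in a further maximal annihilator (J : u); adding to f an element
    of m that lies in all earlier primes but not in (J : u) gives the next
    state.  The new u is never in J plus the ideal of the earlier ones, so the
    process contradicts the stationarity of chains. *)
Lemma regular_element_of_socle_free (m : S -> Prop) : is_ideal m ->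
    (forall u, (forall f, m f -> J (f * u)) -> J u) ->
  exists2 f, m f & forall g, J (f * g) -> J g.
Proof.
move=> hm socle; apply: contrapT => nreg.
pose inv (st : seq S * S) :=
  m st.2 /\ forall u, u \in st.1 -> max_ann u /\ ~ J (st.2 * u).
pose step (st st' : seq S * S) :=
  inv st' /\ exists2 u, st'.1 = rcons st.1 u & ~ adjoins J st.1 u.
have ex_step st : exists st', inv st -> step st st'.
  have [[mf usP]|] := pselect (inv st); last by exists st.
  case: st mf usP => us f /= mf usP.
  have [u maxu fu] : exists2 u, max_ann u & J (f * u).
    apply: contrapT => nu; apply: nreg; exists f => // g jfg.
    apply: contrapT => jg; have [u maxu gu] := maximal_annihilator jg.
    by apply: nu; exists u => //; exact: gu.
  have [ju maxu2] := maxu.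
  have [h mh jhu] : exists2 h, m h & ~ J (h * u).
    apply: contrapT => nh; apply/ju/socle => h mh.
    by apply: contrapT => jhu; apply: nh; exists h.
  (* The factor G is a product of one element for each earlier prime, chosen outside the new one by maximality. *)
  have [G jGu jGus] : exists2 G, ~ J (G * u) & forall v, v \in us -> J (G * v).
    elim: us usP => [|v us IHus] usP; first by exists 1; rewrite ?mul1r.
    have [|G jGu jGus] := IHus; first by move=> w wus; apply: usP; rewrite inE wus orbT.
    have [[jv maxv] jfv] : max_ann v /\ ~ J (f * v) by apply: usP; rewrite inE eqxx.
    have [g jgv jgu] : exists2 g, J (g * v) & ~ J (g * u).
      apply: contrapT => ng; apply/jfv/(maxv u) => // g jgv.
      by apply: contrapT => jgu; apply: ng; exists g.
    exists (G * g); first by rewrite -mulrA => /(max_ann_prime maxu)-/(_ jgu).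
    move=> w; rewrite inE => /orP [/eqP ->|/jGus jw]; first by rewrite -mulrA; exact: idealM.
    by rewrite mulrAC; exact: (ideal_mulr hJ).
  exists (rcons us u, f + G * h) => _; split; last first.
    (* Were u a combination of J and the earlier elements, G u would be in J. *)
    exists u => //= uus; apply: jGu.
    suff : forall s, (forall v, v \in s -> J (G * v)) -> forall J', is_ideal J' ->
        (forall g, J' g -> J (G * g)) -> forall g, adjoins J' s g -> J (G * g).
      by apply; [exact: jGus|exact: hJ|move=> g jg; exact: idealM|exact: uus].
    elim=> [|v s IHs] sG J' hJ' J'G g /=; first exact: J'G.
    apply: IHs; first by move=> w ws; apply: sG; rewrite inE ws orbT.
      exact: adjoin_ideal.
    move=> g' [a /J'G]; rewrite mulrBr mulrCA => jg'.
    apply/(ideal_congr hJ jg'); apply: idealM => //.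
    by apply: sG; rewrite inE eqxx.
  split=> /= [|v]; first by apply: idealD => //; exact: idealM.
  rewrite mem_rcons inE => /orP [/eqP ->|vus]; split=> //.
  - move=> jf'; apply: jGu; apply: (max_ann_prime (b := h) maxu _ jhu).
    rewrite mulrA -[_ * u](addKr (f * u)) -mulrDl; apply: idealD => //.
    exact: idealN.
  - by have [] := usP v vus.
  - have [_ jfv] := usP v vus; move=> jf'; apply: jfv.
    rewrite -[f](addrK (G * h)) mulrBl; apply: idealB => //.
    by rewrite mulrAC; apply: ideal_mulr => //; exact: jGus.
have [next nextP] := choice ex_step.
pose st k := iter k next ([::], 0).
have inv_st k : inv (st k).
  by elim: k => [|k /nextP []//]; split=> //; exact: ideal0.
have [k|k g|k hk] := @ideal_chain_stationary (fun k => adjoins J (st k).1).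
- exact: adjoins_ideal.
- have [_ [u /= -> _]] := nextP _ (inv_st k).
  rewrite -cats1 adjoins_cat => jg /=; apply: adjoin_sub => //.
  exact: adjoins_ideal.
- have [_ [u /= e]] := nextP _ (inv_st k); apply; apply: hk => /=.
  rewrite e -cats1 adjoins_cat /=; apply: adjoin_mem; exact: adjoins_ideal.
Qed.

End Avoidance.

Local Notation vars := [seq 'X_i : S | i <- enum 'I_r].

Lemma regular_sequence_of_depth_ge J k : is_ideal J -> depth_ge vars J k ->
  exists s : seq S, [/\ size s = k, forall f, f \in s -> in_ideal_gen (fun x => x \in vars) f
    & regular J s].
Proof.
elim: k J => [|k IHk] J hJ hk; first by exists [::].
have [|f mf rf] := regular_element_of_socle_free hJ (in_ideal_gen_ideal (fun x => x \in vars)).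
  move=> u hu; apply: (depth_ge1 vars hJ).1; first exact: depth_ge_leq hk.
  by move=> x xl; apply/hu/in_ideal_gen_mem.
have [|s [ss ms rs]] := IHk _ (adjoin_ideal f hJ); first exact: depth_ge_adjoin.
exists (f :: s); split=> //=; first by rewrite ss.
by move=> g; rewrite inE => /orP [/eqP ->|/ms].
Qed.

End Noetherian.

(** * Depth of a cyclic module through Koszul cohomology *)

Lemma nat_max_eq (P : nat -> Prop) m :
  P m -> (forall k, P k -> k <= m) -> nat_max P = m.
Proof.
move=> Pm maxm; rewrite /nat_max; case: pselect => [h|[]]; last by exists m.
case: (cid h) => /= k [Pk maxk]; apply/eqP; rewrite eqn_leq maxm //; exact: maxk.
Qed.

Lemma ex_nat_max (P : nat -> Prop) b : (exists m, P m) -> (forall k, P k -> k <= b) ->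
  exists2 m, P m & forall k, P k -> k <= m.
Proof.
move=> [m0 Pm0] Pb.
have ex : exists m, `[< P m >] by exists m0; exact/asboolP.
have ub m : `[< P m >] -> m <= b by move/asboolP/Pb.
case: (ex_maxnP ex ub) => m /asboolP Pm maxm; exists m => // k Pk.
by apply: maxm; apply/asboolP.
Qed.

Section RegularSeq.
Variables (R : comNzRingType) (G : R -> Prop).
Local Open Scope ring_scope.

Lemma in_seq_mul_proj (s : seq R) (g : R) :
  in_seq_mul s (proj G g) <-> adjoins (in_ideal_gen G) s g.
Proof.
rewrite adjoinsE; last exact: in_ideal_gen_ideal.
have sumE (c : nat -> R) :
    \sum_(i < size s) s`_i *: proj G (c i) = proj G (\sum_(i < size s) s`_i * c i).
  elim/big_rec2: _ => [|i x y _ ->].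
    by apply/esym; have := projB G 0 0; rewrite !subr0 subrr.
  by rewrite projD; congr (_ + _); exact: quot_scale_proj.
split=> [[y gE]|[c jc]].
  have [y' y'E] : exists y' : nat -> quot_gen G, forall i : 'I_(size s), y i = y' i.
    case: (size s) y {gE sumE} => [|n] y; first by exists (fun=> 0) => [[]].
    by exists (y \o inord) => i /=; rewrite inord_val.
  have [c cE] : exists c : nat -> R, forall i, y' i = proj G (c i).
    by exists (fun i => repr (y' i : {ideal_quot (ideal_gen_zmod G)})) => i; rewrite proj_repr.
  exists c; apply/asboolP/proj_eq; rewrite -sumE gE.
  by apply: eq_bigr => i _; rewrite y'E cE.
exists (fun i => proj G (c i)); rewrite sumE.
by apply/proj_eq/asboolP.
Qed.

Lemma regularP J (s : seq R) : regular J s <-> forall i, (i < size s)%N ->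
  forall g, adjoins J (take i s) (s`_i * g) -> adjoins J (take i s) g.
Proof.
elim: s J => [|f s IHs] J //=; split=> [[rf /IHs rs]|h].
  by case=> [_ g|i i_s g] /=; [exact: rf|exact: rs].
split; first exact: (h 0%N).
by apply/IHs => i i_s; exact: (h i.+1).
Qed.

Lemma regular_seq_proj (s : seq R) :
  regular_seq (quot_gen G) s <->
  regular (in_ideal_gen G) s /\ exists g, ~ adjoins (in_ideal_gen G) s g.
Proof.
split=> [[h [x hx]]|[/regularP h [g hg]]]; split.
- apply/regularP => i i_s g; rewrite -!in_seq_mul_proj => hg; apply: h => //.
  by rewrite [_ *: _]quot_scale_proj.
- by exists (repr (x : {ideal_quot (ideal_gen_zmod G)})); rewrite -in_seq_mul_proj proj_repr.
- move=> i i_s x; rewrite -[x]proj_repr [_ *: _]quot_scale_proj !in_seq_mul_proj.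
  exact: h.
- by exists (proj G g); rewrite in_seq_mul_proj.
Qed.

End RegularSeq.

Section Polynomials.
Variables (K : fieldType) (r : nat).
Local Notation S := {mpoly K[r]}.
Local Open Scope ring_scope.
Implicit Types (f g : S) (m : 'X_{1..r}).

Definition vars : seq S := [seq 'X_i | i <- enum 'I_r].

Definition irrelevant : S -> Prop := in_ideal_gen (fun x => x \in vars).

Definition monomials (E : 'X_{1..r} -> Prop) : S -> Prop :=
  fun f => exists2 m, E m & f = 'X_[m].

(** Membership in a monomial ideal is tested on each monomial separately. *)
Lemma monomial_idealP (E : 'X_{1..r} -> Prop) f :
  in_ideal_gen (monomials E) f <->
  forall m, m \in msupp f -> exists2 e, E e & (e <= m)%MM.
Proof.
split; last first.
  move=> h; rewrite [f]mpolyE big_seq.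
  apply: ideal_sum; first exact: in_ideal_gen_ideal.
  move=> m /h [e Ee em]; rewrite -(submK em) mpolyXD scalerAl.
  apply: idealM; first exact: in_ideal_gen_ideal.
  by apply: in_ideal_gen_mem; exists e.
move: f; apply: in_ideal_gen_min; last first.
  by move=> _ [e Ee ->] m; rewrite msuppX inE => /eqP ->; exists e; rewrite ?lepm_refl.
split=> [m|f g hf hg m /msuppD_le|a f hf m /msuppM_le /allpairsP [[m1 m2] /= [_ /hf [e Ee em] ->]]].
- by rewrite msupp0.
- by rewrite mem_cat => /orP [/hf|/hg].
by exists e => //; apply: lepm_trans em _; exact: lem_addl.
Qed.

Lemma mem_vars x : x \in vars <-> exists i, x = 'X_i.
Proof.
split=> [/mapP [i _ ->]|[i ->]]; first by exists i.
by apply/map_f; rewrite mem_enum.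
Qed.

Lemma irrelevantP f : irrelevant f <-> max_ideal f.
Proof.
rewrite /irrelevant (_ : (fun x : S => is_true (x \in vars)) = monomials (fun e => exists i, e = U_(i)%MM)).
  rewrite monomial_idealP /max_ideal; split=> [h|f0 m mf].
    apply: memN_msupp_eq0; apply/negP => /h [_ [i ->]]; rewrite lep1mP.
    by rewrite mnm0E.
  suff [i mi] : exists i, m i != 0%N by exists U_(i)%MM; [exists i|rewrite lep1mP].
  apply: contrapT => nm; move: mf; rewrite mcoeff_msupp => /eqP; apply.
  rewrite (_ : m = 0%MM) //; apply/mnmP => i; rewrite mnm0E; apply/eqP.
  by apply: contrapT => mi; apply: nm; exists i; apply/negP.
apply/funext => x; apply/propext; rewrite mem_vars; split=> [[i ->]|[_ [i ->] ->]].
  by exists U_(i)%MM => //; exists i.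
by exists i.
Qed.

Lemma irrelevant_ideal : is_ideal irrelevant.
Proof. exact: in_ideal_gen_ideal. Qed.

Lemma not_irrelevant1 : ~ irrelevant 1.
Proof. by move/irrelevantP; rewrite /max_ideal mcoeff1 eqxx => /eqP; rewrite oner_eq0. Qed.

Lemma adjoins_irrelevant J s : (forall f, J f -> irrelevant f) ->
  (forall f, f \in s -> irrelevant f) -> forall f, adjoins J s f -> irrelevant f.
Proof.
elim: s J => [|g s IHs] J Jm sm //=; apply: IHs; last first.
  by move=> f fs; apply: sm; rewrite inE fs orbT.
move=> f [a /Jm h]; apply/(ideal_congr irrelevant_ideal h).
by apply: idealM; [exact: irrelevant_ideal|apply: sm; rewrite inE eqxx].
Qed.

Section Depth.
Variables (G : S -> Prop) (GM : forall f, G f -> irrelevant f).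
Let J := in_ideal_gen G.
Let hJ : is_ideal J := in_ideal_gen_ideal G.
Let JM f : J f -> irrelevant f.
Proof. by apply: in_ideal_gen_min => //; exact: irrelevant_ideal. Qed.

(** Regular sequences in the irrelevant ideal are automatically proper, since
    J and the sequence generate an ideal without 1. *)
Lemma depth_eq d : depth_ge vars J d -> ~ depth_ge vars J d.+1 -> depth (quot_gen G) = d.
Proof.
move=> hd hd1; apply: nat_max_eq => [|k [s [<- sm /regular_seq_proj [rs _]]]].
  have [s [ss sm rs]] := regular_sequence_of_depth_ge hJ hd; exists s; split=> //.
    by move=> f /sm /irrelevantP.
  apply/regular_seq_proj; split=> //; exists 1 => /adjoins_irrelevant.
  by move/(_ JM sm); exact: not_irrelevant1.
have h : depth_ge vars J (size s).
  rewrite -[size s]addn0; apply: depth_ge_regular => // f /sm.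
  by move/irrelevantP.
by rewrite leqNgt; apply/negP => ds; apply: hd1; exact: depth_ge_leq h.
Qed.

Lemma depth_geP : depth_ge vars J (depth (quot_gen G)) /\
  ~ depth_ge vars J (depth (quot_gen G)).+1.
Proof.
have [||d hd maxd] := @ex_nat_max (depth_ge vars J) (size vars).
- by exists 0%N.
- move=> k hk; rewrite leqNgt; apply/negP => rk.
  by apply: (depth_ge_bound hJ JM not_irrelevant1); exact: depth_ge_leq hk.
have hd1 : ~ depth_ge vars J d.+1 by move/maxd; rewrite ltnn.
by rewrite (depth_eq hd hd1).
Qed.

End Depth.

End Polynomials.

(** * Ideals in disjoint sets of variables *)

Section Subrings.
Variables (K : fieldType) (r : nat).
Local Notation S := {mpoly K[r]}.
Local Open Scope ring_scope.
Implicit Types (X Y : {set 'I_r}) (f g p : S) (m : 'X_{1..r}).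

Lemma poly_in_sub X Y p : X \subset Y -> poly_in X p -> poly_in Y p.
Proof. by move=> /subsetP XY pX m mp i mi; apply/XY/(pX m). Qed.

Lemma poly_in0 X : poly_in X (0 : S).
Proof. by move=> m; rewrite msupp0. Qed.

Lemma poly_inD X p q : poly_in X p -> poly_in X q -> poly_in X (p + q).
Proof. by move=> pX qX m /msuppD_le; rewrite mem_cat => /orP [/pX|/qX]. Qed.

Lemma poly_inM X p q : poly_in X p -> poly_in X q -> poly_in X (p * q).
Proof.
move=> pX qX m /msuppM_le /allpairsP [[m1 m2] /= [/pX h1 /qX h2 ->]] i.
by rewrite mnmDE addn_eq0 negb_and => /orP [/h1|/h2].
Qed.

Lemma poly_inZ X c p : poly_in X p -> poly_in X (c *: p).
Proof. by move=> pX m /msuppZ_le /pX. Qed.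

Lemma poly_inN X p : poly_in X p -> poly_in X (- p).
Proof. by move=> pX; rewrite -scaleN1r; exact: poly_inZ. Qed.

Lemma poly_inX X m : (forall i, m i != 0%N -> i \in X) -> poly_in X ('X_[m] : S).
Proof. by move=> mX m'; rewrite msuppX inE => /eqP ->. Qed.

Lemma poly_inXU X i : i \in X -> poly_in X ('X_i : S).
Proof. by move=> iX; apply: poly_inX => j; rewrite mnm1E; have [<-|] := eqVneq i j. Qed.

Lemma poly_in1 X : poly_in X (1 : S).
Proof. by rewrite -mpolyX0; apply: poly_inX => i; rewrite mnm0E. Qed.

Definition mrestr X m : 'X_{1..r} := [multinom (if i \in X then m i else 0)%N | i < r].

Lemma mrestrD X m : (mrestr X m + mrestr (~: X) m)%MM = m.
Proof.
by apply/mnmP => i; rewrite mnmDE !mnmE inE; case: (i \in X); rewrite ?addn0 ?add0n.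
Qed.

Lemma mrestr_id X m : (forall i, m i != 0%N -> i \in X) -> mrestr X m = m.
Proof.
move=> mX; apply/mnmP => i; rewrite mnmE; case: ifPn => // iX.
by apply/eqP; rewrite eq_sym; apply: contraNT iX => /mX.
Qed.

Lemma mrestr_eq0 X m : (forall i, m i != 0%N -> i \in ~: X) -> mrestr X m = 0%MM.
Proof.
move=> mX; apply/mnmP => i; rewrite mnmE mnm0E; case: ifPn => // iX.
by apply/eqP; apply: contraTT iX => /mX; rewrite inE.
Qed.

Lemma poly_in_mrestr X m : poly_in X ('X_[mrestr X m] : S).
Proof. by apply: poly_inX => i; rewrite mnmE; case: ifP. Qed.

(** Polynomials in the variables of X with coefficients in the other
    variables; the ring of coefficients is taken too large so that no
    renumbering is needed. *)
Definition split_vars X : S -> {mpoly S[r]} :=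
  mmap (mpolyC r (R := S) \o mpolyC r (R := K))
    (fun i => if i \in X then 'X_i else ('X_i)%:MP).

HB.instance Definition _ X := GRing.RMorphism.on (split_vars X).

Lemma split_varsX X m :
  split_vars X 'X_[m] = ('X_[mrestr (~: X) m])%:MP * 'X_[mrestr X m].
Proof.
rewrite /split_vars mmapX /mmap1 !mpolyXE_id rmorph_prod -big_split /=.
apply: eq_bigr => i _; rewrite !mnmE inE rmorphXn /=.
by case: (i \in X); rewrite /= ?expr0 ?mul1r ?mulr1.
Qed.

Lemma split_varsZ X c f : split_vars X (c *: f) = (c%:MP)%:MP * split_vars X f.
Proof. exact: mmapZ. Qed.

Lemma split_vars_out X f : poly_in (~: X) f -> split_vars X f = f%:MP.
Proof.
move=> fX; rewrite {1}[f]mpolyE raddf_sum [in RHS](mpolyE f) raddf_sum /=.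
rewrite big_seq [RHS]big_seq; apply: eq_bigr => m mf; rewrite split_varsZ split_varsX.
rewrite mrestr_id ?(mrestr_eq0 (X := X)) ?mpolyX0 ?mulr1; last exact: fX.
  by rewrite -mpolyCM mul_mpolyC.
exact: fX.
Qed.

Lemma split_vars_in X f a : poly_in X f -> (split_vars X f)@_a = (f@_a)%:MP.
Proof.
move=> fX; rewrite {1}[f]mpolyE (raddf_sum (split_vars X)) (raddf_sum (mcoeff a)) [in RHS](mpolyE f) raddf_sum raddf_sum /=.
rewrite big_seq [RHS]big_seq; apply: eq_bigr => m mf; rewrite split_varsZ split_varsX.
rewrite (mrestr_id (X := X)) ?(mrestr_eq0 (X := ~: X)) ?setCK; try exact: fX.
rewrite mpolyX0 mul1r mcoeffCM mcoeffX mcoeffZ mcoeffX mpolyCM.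
by congr (_ * _); rewrite mpolyC_nat.
Qed.

End Subrings.
Arguments split_vars {K r} X f.

Section Tensor.
Variables (K : fieldType) (r : nat) (X : {set 'I_r}).
Local Notation S := {mpoly K[r]}.
Local Notation Y := (~: X).
Local Open Scope ring_scope.
Implicit Types (f g p : S) (m : 'X_{1..r}) (G : S -> Prop) (ab pc : seq (S * S)).

(** Lists of pairs stand for elements of K[X] tensor K[Y], and [ptens] for the
    product map to S. *)
Definition ptens ab := \sum_(x <- ab) x.1 * x.2.
Definition is_tens ab := forall x, x \in ab -> poly_in X x.1 /\ poly_in Y x.2.

Lemma ptens_nil : ptens [::] = 0. Proof. exact: big_nil. Qed.
Lemma ptens_cons x ab : ptens (x :: ab) = x.1 * x.2 + ptens ab.
Proof. exact: big_cons. Qed.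

Lemma is_tens_cons x ab :
  is_tens (x :: ab) <-> (poly_in X x.1 /\ poly_in Y x.2) /\ is_tens ab.
Proof.
split=> [h|[hx h] y]; last by rewrite inE => /orP [/eqP ->|/h].
split; first by apply: h; rewrite inE eqxx.
by move=> y yab; apply: h; rewrite inE yab orbT.
Qed.

Lemma ex_ptens f : exists2 ab, is_tens ab & f = ptens ab.
Proof.
exists [seq (f@_m *: 'X_[mrestr X m], 'X_[mrestr Y m]) | m <- msupp f].
  by move=> _ /mapP [m _ ->]; split; [apply: poly_inZ|]; exact: poly_in_mrestr.
rewrite {1}[f]mpolyE /ptens [RHS]big_map; apply: eq_bigr => m _ /=.
by rewrite -scalerAl -mpolyXD mrestrD.
Qed.

Section FixQ.
Variables (GQ : S -> Prop) (hGQ : forall q, GQ q -> poly_in Y q).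
Let Q := in_ideal_gen GQ.
Let hQ : is_ideal Q := in_ideal_gen_ideal GQ.

(** An ideal generated by polynomials free of X is homogeneous for the grading
    by the exponents of X. *)
Lemma mcoeff_split_vars_ideal f : Q f -> forall a, Q (split_vars X f)@_a.
Proof.
move: f; apply: in_ideal_gen_min.
  split=> [a|f g qf qg a|c f qf a].
  - by rewrite (rmorph0 (split_vars X)) mcoeff0; exact: (ideal0 hQ).
  - by rewrite (rmorphD (split_vars X)) mcoeffD; exact: (idealD hQ (qf a) (qg a)).
  - rewrite (rmorphM (split_vars X)) mcoeffM; apply: (ideal_sum hQ) => k _.
    by apply: (idealM hQ); exact: qf.
move=> q GQq a; rewrite split_vars_out; last exact: hGQ.
by rewrite mcoeffC; apply: (ideal_mulr hQ); exact: in_ideal_gen_mem.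
Qed.

(** The K-span of bs modulo Q. *)
Fixpoint lspan (bs : seq S) : S -> Prop :=
  if bs is b :: bs' then fun x => exists c : K, lspan bs' (x - c *: b) else Q.

Fixpoint lindep (bs : seq S) : Prop :=
  if bs is b :: bs' then ~ lspan bs' b /\ lindep bs' else True.

Lemma lspanZ bs c x : lspan bs x -> lspan bs (c *: x).
Proof.
elim: bs x => [|b bs IHbs] x /=; first by rewrite -mul_mpolyC; exact: idealM.
by case=> d /IHbs h; exists (c * d); rewrite -scalerA -scalerBr.
Qed.

Lemma lspan_comb (cb : seq (K * S)) x :
  Q (x - \sum_(y <- cb) y.1 *: y.2) -> lspan (unzip2 cb) x.
Proof.
elim: cb x => [|[c b] cb IHcb] x /=; first by rewrite big_nil subr0.
by rewrite big_cons opprD addrA => /IHcb; exists c.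
Qed.

Lemma lindep_comb (cb : seq (K * S)) : lindep (unzip2 cb) ->
  Q (\sum_(y <- cb) y.1 *: y.2) -> forall y, y \in cb -> y.1 = 0.
Proof.
elim: cb => [|[c b] cb IHcb] //= [nb ib]; rewrite big_cons /= => qs.
have c0 : c = 0.
  apply: contra_notP nb => /eqP c0.
  rewrite -[b]scale1r -(mulVf c0) -scalerA; apply: lspanZ.
  rewrite -[_ *: b]opprK -scaleN1r; apply/lspanZ/lspan_comb.
  by rewrite -opprD addrC; apply: idealN => //; rewrite addrC.
move=> y; rewrite inE => /orP [/eqP -> //|]; apply: IHcb => //.
by move: qs; rewrite c0 scale0r add0r.
Qed.

(** Extract the coefficient of each monomial in the variables of X. *)
Lemma tens_zero ab : is_tens ab -> lindep (unzip2 ab) -> Q (ptens ab) ->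
  forall x, x \in ab -> x.1 = 0.
Proof.
move=> tab iab /mcoeff_split_vars_ideal qab x xab; apply/mpolyP => a; rewrite mcoeff0.
pose cb := [seq (y.1@_a, y.2) | y <- ab].
suff h : forall y, y \in cb -> y.1 = 0 by apply: (h (x.1@_a, x.2)); exact: (map_f (fun y => (y.1@_a, y.2))).
apply: lindep_comb; first by rewrite /unzip2 -map_comp.
move: (qab a); rewrite /ptens (raddf_sum (split_vars X)) (raddf_sum (mcoeff a)) /= big_map.
rewrite big_seq [X in _ -> Q X]big_seq (eq_bigr (fun y => y.1@_a *: y.2)) // => y yab.
have [y1 y2] := tab y yab.
by rewrite rmorphM /= (split_vars_out y2) mulrC mcoeffCM split_vars_in // mulrC mul_mpolyC.
Qed.

(** A term p c whose second factor depends linearly on those of ab modulo Q is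
    absorbed into ab by changing only the first factors, by scalar multiples
    of p. *)
Lemma tens_absorb (P : S -> Prop) ab p c : is_ideal P -> P p -> poly_in X p ->
    poly_in Y c -> is_tens ab -> lspan (unzip2 ab) c ->
  exists ab', [/\ unzip2 ab' = unzip2 ab, is_tens ab',
    (forall x, x \in ab' -> P x.1) -> forall x, x \in ab -> P x.1
    & Q (ptens ab + p * c - ptens ab')].
Proof.
move=> hP Pp pX; elim: ab c => [|[a b] ab IHab] c cY /=.
  move=> _ qc; exists [::]; split=> //.
  by rewrite ptens_nil add0r subr0; exact: idealM.
move=> /is_tens_cons [/= [aX bY] tab] [d sp].
have [|ab' [e tab' pab' qab']] := IHab (c - d *: b) _ tab sp.
  by apply: poly_inD => //; apply/poly_inN/poly_inZ.
exists ((a + d *: p, b) :: ab'); split.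
- by rewrite /= e.
- by apply/is_tens_cons; split=> //; split=> //; apply: poly_inD => //; exact: poly_inZ.
- move=> h x; rewrite inE => /orP [/eqP -> /=|]; last first.
    by apply: pab' => y yab'; apply: h; rewrite inE yab' orbT.
  have : P (a + d *: p) by apply: (h (_, b)); rewrite inE eqxx.
  move=> Pad; rewrite -[a](addrK (d *: p)); apply: idealB => //.
  by rewrite -mul_mpolyC; exact: idealM.
rewrite !ptens_cons /=; move: qab'; congr Q.
rewrite -!mul_mpolyC; ring.
Qed.

Lemma ex_lindep_tens ab : is_tens ab ->
  exists ab', [/\ is_tens ab', lindep (unzip2 ab') & Q (ptens ab - ptens ab')].
Proof.
elim: ab => [|[a b] ab IHab].
  by move=> _; exists [::]; split=> //; rewrite subrr; exact: ideal0.
move=> /is_tens_cons [/= [aX bY] /IHab [ab1 [tab1 iab1 q1]]].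
have [sp|nsp] := pselect (lspan (unzip2 ab1) b); last first.
  exists ((a, b) :: ab1); split=> //; first exact/is_tens_cons.
  by rewrite !ptens_cons opprD addrACA subrr add0r.
have hT : is_ideal (fun _ : S => True) by split.
have [ab' [e tab' _ q']] := tens_absorb hT I aX bY tab1 sp.
exists ab'; split=> //; first by rewrite e.
rewrite ptens_cons /= -[ptens ab](subrK (ptens ab1)) addrCA -addrA.
by rewrite [a * b + _]addrC; exact: idealD.
Qed.

Section FixP.
Variables (GP : S -> Prop) (hGP : forall p, GP p -> poly_in X p).
Let P := in_ideal_gen GP.
Let hP : is_ideal P := in_ideal_gen_ideal GP.
Let PQ := in_ideal_gen (fun f => GP f \/ GQ f).
Let hPQ : is_ideal PQ := in_ideal_gen_ideal _.

Let subP f : P f -> PQ f.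
Proof. by apply: in_ideal_gen_min => // g Gg; apply: in_ideal_gen_mem; left. Qed.

Let subQ f : Q f -> PQ f.
Proof. by apply: in_ideal_gen_min => // g Gg; apply: in_ideal_gen_mem; right. Qed.

Lemma sum_ideal_tens f : PQ f ->
  exists pc, [/\ is_tens pc, forall x, x \in pc -> P x.1 & Q (f - ptens pc)].
Proof.
move: f; pose T f := exists pc, [/\ is_tens pc, forall x, x \in pc -> P x.1 & Q (f - ptens pc)].
have T0 f : Q f -> T f by exists [::]; split=> //; rewrite ptens_nil subr0.
have TD f g : T f -> T g -> T (f + g).
  move=> [pc [t1 p1 q1]] [pc' [t2 p2 q2]]; exists (pc ++ pc'); split.
  - by move=> x; rewrite mem_cat => /orP [/t1|/t2].
  - by move=> x; rewrite mem_cat => /orP [/p1|/p2].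
  - by rewrite /ptens big_cat /= opprD addrACA; exact: idealD.
have TM u v f : poly_in X u -> poly_in Y v -> T f -> T (u * v * f).
  move=> uX vY [pc [t1 p1 q1]]; exists [seq (u * x.1, v * x.2) | x <- pc]; split.
  - by move=> _ /mapP [x /t1 [? ?] ->]; split; exact: poly_inM.
  - by move=> _ /mapP [x /p1 ? ->]; exact: idealM.
  have -> : ptens [seq (u * x.1, v * x.2) | x <- pc] = u * v * ptens pc.
    by rewrite /ptens big_map mulr_sumr; apply: eq_bigr => x _ /=; rewrite mulrACA.
  by rewrite -mulrBr; exact: idealM.
apply: in_ideal_gen_min.
  split=> [|//|a f Tf]; first by apply: T0; exact: ideal0.
  have [ab tab ->] := ex_ptens a; rewrite /ptens big_seq mulr_suml.
  by apply: (big_ind T) => [|//|x /tab [? ?]]; [apply: T0; exact: ideal0|exact: TM].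
move=> f [GPf|GQf]; last by apply: T0; exact: in_ideal_gen_mem.
exists [:: (f, 1)]; split.
- move=> x; rewrite inE => /eqP ->; split; [exact: hGP|exact: poly_in1].
- by move=> x; rewrite inE => /eqP ->; exact: in_ideal_gen_mem.
- by rewrite ptens_cons ptens_nil addr0 mulr1 subrr; exact: ideal0.
Qed.

(** The algebra K[X]/P tensor K[Y]/Q is free over K[X]/P, on any basis of
    K[Y]/Q.  To avoid choosing a basis, the finitely many terms of an element
    of P + Q are moved one by one into ab, either as new independent terms or
    by absorption. *)
Lemma tens_coefficients ab : is_tens ab -> lindep (unzip2 ab) -> PQ (ptens ab) ->
  forall x, x \in ab -> P x.1.
Proof.
move=> tab iab /sum_ideal_tens [pc [tpc ppc]].
elim: pc ab tab iab tpc ppc => [|[p c] pc IHpc] ab tab iab tpc ppc.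
  rewrite ptens_nil subr0 => q x xab; rewrite (tens_zero tab iab q xab).
  exact: ideal0.
have [[/= pX cY] tpc'] := (is_tens_cons _ _).1 tpc.
have Pp : P p by apply: (ppc (p, c)); rewrite inE eqxx.
have ppc' x : x \in pc -> P x.1 by move=> xpc; apply: ppc; rewrite inE xpc orbT.
rewrite ptens_cons /= => q.
have [sp|nsp] := pselect (lspan (unzip2 ab) c); last first.
  move=> x xab; apply: (IHpc ((- p, c) :: ab)) => //; last by rewrite inE xab orbT.
    by apply/is_tens_cons; split=> //; split=> //; exact: poly_inN.
  rewrite ptens_cons /=; move: q; congr Q; ring.
have Pp' : P (- p) by exact: idealN.
have [ab' [e tab' pab' q']] := tens_absorb hP Pp' (poly_inN pX) cY tab sp.
apply: pab'; apply: (IHpc ab') => //; first by rewrite e.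
have -> : ptens ab' - ptens pc =
    (ptens ab - (p * c + ptens pc)) - (ptens ab + - p * c - ptens ab') by ring.
exact: idealB.
Qed.

(** Flatness: a regular element stays regular after tensoring with K[Y]/Q. *)
Lemma regular_tensor f : poly_in X f -> (forall g, P (f * g) -> P g) ->
  forall g, PQ (f * g) -> PQ g.
Proof.
move=> fX rf u; have [ab0 tab0 ->] := ex_ptens u.
have [ab [tab iab qab]] := ex_lindep_tens tab0.
have congrPQ (v : S) : PQ (v * ptens ab0) <-> PQ (v * ptens ab).
  by apply: ideal_congr => //; rewrite -mulrBr; apply: idealM => //; exact: subQ.
move=> /congrPQ fab; rewrite -[ptens ab0]mul1r; apply/congrPQ; rewrite mul1r.
pose fb := [seq (f * x.1, x.2) | x <- ab].
have fbE : ptens fb = f * ptens ab.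
  by rewrite /ptens big_map mulr_sumr; apply: eq_bigr => x _ /=; rewrite mulrA.
have Pab x : x \in ab -> P x.1.
  move=> xab; apply: rf; apply: (@tens_coefficients fb _ _ _ (f * x.1, x.2)).
  - by move=> _ /mapP [y /tab [? ?] ->]; split=> //; exact: poly_inM.
  - by rewrite /unzip2 -map_comp.
  - by rewrite fbE.
  - exact: (map_f (fun x => (f * x.1, x.2))).
rewrite /ptens big_seq; apply: ideal_sum => // x /Pab px.
by apply: (ideal_mulr hPQ); exact: subP.
Qed.

Lemma tensor_mul_not_mem g h : poly_in X g -> poly_in Y h -> PQ (g * h) -> P g \/ Q h.
Proof.
move=> gX hY gh; have [qh|nqh] := pselect (Q h); [by right|left].
apply: (@tens_coefficients [:: (g, h)] _ _ _ (g, h)); last by rewrite inE.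
- by move=> x; rewrite inE => /eqP ->.
- by [].
- by rewrite ptens_cons ptens_nil addr0.
Qed.

End FixP.
End FixQ.
End Tensor.

(** * Additivity of depth over disjoint sets of variables *)

Section DepthData.
Variables (K : fieldType) (r : nat).
Local Notation S := {mpoly K[r]}.
Local Open Scope ring_scope.
Implicit Types (X Y : {set 'I_r}) (f g p : S) (G : S -> Prop) (s t : seq S).

(** The element g spans a line in the socle modulo the sequence, which
    therefore cannot be prolonged. *)
Definition maximal_regular X G s g :=
  [/\ forall f, f \in s -> poly_in X f /\ irrelevant f,
      regular (in_ideal_gen G) s,
      poly_in X g,
      ~ adjoins (in_ideal_gen G) s g
    & forall i, i \in X -> adjoins (in_ideal_gen G) s ('X_i * g)].

(** A certificate that K[X]/(G) has depth k, in a form that can be transported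
    to larger polynomial rings. *)
Definition exact_depth X G k :=
  (forall f, G f -> poly_in X f) /\
  exists s g, size s = k /\ maximal_regular X G s g.

Lemma regular_union X Y G G' s : [disjoint X & Y] ->
    (forall f, G f -> poly_in X f) -> (forall f, G' f -> poly_in Y f) ->
    (forall f, f \in s -> poly_in X f) -> regular (in_ideal_gen G) s ->
  regular (in_ideal_gen (fun f => G f \/ G' f)) s.
Proof.
move=> dXY; have YX : Y \subset ~: X by rewrite -disjoints_subset disjoint_sym.
move=> GX G'Y; elim: s G GX => [|f s IHs] G GX sX //= [rf rs]; split.
  apply: (regular_tensor (X := X)) => //; first by move=> q /G'Y; exact: poly_in_sub.
  by apply: sX; rewrite inE eqxx.
rewrite adjoin_gen; rewrite adjoin_gen in rs.
rewrite (@in_ideal_gen_eq _ _ (fun g => (G g \/ g = f) \/ G' g)); first last.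
- by move=> g h; apply: in_ideal_gen_mem; tauto.
- by move=> g h; apply: in_ideal_gen_mem; tauto.
apply: IHs rs; last by move=> g gs; apply: sX; rewrite inE gs orbT.
by move=> g [/GX //|->]; apply: sX; rewrite inE eqxx.
Qed.

Lemma exact_depth_union X Y G G' k l : [disjoint X & Y] ->
    exact_depth X G k -> exact_depth Y G' l ->
  exact_depth (X :|: Y) (fun f => G f \/ G' f) (k + l).
Proof.
move=> dXY; have YX : Y \subset ~: X by rewrite -disjoints_subset disjoint_sym.
have [XU YU] := (subsetUl X Y, subsetUr X Y).
move=> [GX [s [g [<- [sX rs gX ng gs]]]]] [G'Y [t [h [<- [tY rt hY nh ht]]]]].
have adjE : adjoins (in_ideal_gen (fun f => G f \/ G' f)) (s ++ t) =
    in_ideal_gen (fun f => (G f \/ f \in s) \/ (G' f \/ f \in t)).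
  rewrite adjoins_gen; congr in_ideal_gen; apply/funext => f; apply/propext.
  rewrite mem_cat; split; first by case=> [|/orP []]; tauto.
  by case=> -[] e; rewrite ?e ?orbT; first [tauto|right].
have GsX f : G f \/ f \in s -> poly_in X f by case=> [/GX|/sX []].
have GtY f : G' f \/ f \in t -> poly_in Y f by case=> [/G'Y|/tY []].
split; first by move=> f [/GX|/G'Y]; exact: poly_in_sub.
exists (s ++ t), (g * h); split; first by rewrite size_cat.
split.
- move=> f; rewrite mem_cat => /orP [/sX|/tY] [fX fm]; split=> //.
    exact: poly_in_sub fX.
  exact: poly_in_sub fX.
- apply/regular_cat; split.
    by apply: (regular_union dXY) => // f /sX [].
  rewrite adjoins_gen (@in_ideal_gen_eq _ _ (fun f => G' f \/ (G f \/ f \in s))); first last.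
  - by move=> f hf; apply: in_ideal_gen_mem; tauto.
  - by move=> f hf; apply: in_ideal_gen_mem; tauto.
  apply: (@regular_union Y X) => //; first by rewrite disjoint_sym.
  by move=> f /tY [].
- by apply: poly_inM; [exact: poly_in_sub gX|exact: poly_in_sub hY].
- rewrite adjE => gh; rewrite adjoins_gen in ng; rewrite adjoins_gen in nh.
  have GtX f : G' f \/ f \in t -> poly_in (~: X) f by move=> /GtY; exact: poly_in_sub.
  by have [] := tensor_mul_not_mem GtX GsX gX (poly_in_sub YX hY) gh.
- move=> i; rewrite inE adjE; rewrite adjoins_gen in gs; rewrite adjoins_gen in ht.
  have idl := in_ideal_gen_ideal (fun f => (G f \/ f \in s) \/ (G' f \/ f \in t)).
  case/orP => [/gs|/ht] hi.
    rewrite mulrA; apply: (ideal_mulr idl); apply: in_ideal_gen_min hi => // f hf.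
    by apply: in_ideal_gen_mem; left.
  rewrite mulrCA; apply: (idealM idl); apply: in_ideal_gen_min hi => // f hf.
  by apply: in_ideal_gen_mem; right.
Qed.

Lemma exact_depth0 : exact_depth set0 (fun=> False) 0.
Proof.
split=> //; exists [::], 1; split=> //; split=> //=; first exact: poly_in1.
  move=> h; apply: (@not_irrelevant1 K r).
  by apply: in_ideal_gen_min h => //; exact: irrelevant_ideal.
by move=> i; rewrite inE.
Qed.

Lemma exact_depth_ext X G X' G' k k' : X = X' -> (forall f, G f <-> G' f) -> k = k' ->
  exact_depth X G k -> exact_depth X' G' k'.
Proof.
move=> -> GG' ->; suff -> : G = G' by [].
by apply/funext => f; apply/propext.
Qed.

Lemma exact_depth_bigcup (I : eqType) (js : seq I) (X : I -> {set 'I_r})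
    (G : I -> S -> Prop) (k : I -> nat) : uniq js ->
    (forall i j, i != j -> [disjoint X i & X j]) ->
    (forall i, i \in js -> exact_depth (X i) (G i) (k i)) ->
  exact_depth (\bigcup_(i <- js) X i) (fun f => exists2 i, i \in js & G i f)
    (\sum_(i <- js) k i)%N.
Proof.
move=> + dX; elim: js => [|j js IHjs] /=.
  move=> _ _; apply: exact_depth_ext exact_depth0; rewrite ?big_nil //.
  by move=> f; split=> // -[].
move=> /andP [njs ujs] hX; apply: exact_depth_ext (exact_depth_union _ (hX j _) (IHjs ujs _)).
- by rewrite big_cons.
- move=> f; split=> [[Gf|[i ijs Gf]]|[i]].
  + by exists j; rewrite // inE eqxx.
  + by exists i; rewrite // inE ijs orbT.
  + by rewrite inE => /orP [/eqP ->|ijs] Gf; [left|right; exists i].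
- by rewrite big_cons.
- rewrite big_seq; apply: (big_ind (fun Y => [disjoint X j & Y])).
  + by rewrite -setI_eq0 setI0.
  + move=> A B; rewrite -!setI_eq0 setIUr => /eqP -> /eqP ->.
    by rewrite setU0.
  + by move=> i ijs; apply: dX; apply: contraNneq njs => ->.
- by rewrite inE eqxx.
- by move=> i ijs; apply: hX; rewrite inE ijs orbT.
Qed.

(** The element g is a nonzero degree-zero class modulo the sequence, which
    shifts to a nonzero class in degree k. *)
Lemma exact_depth_total G k : exact_depth setT G k ->
  depth_ge (vars K r) (in_ideal_gen G) k /\ ~ depth_ge (vars K r) (in_ideal_gen G) k.+1.
Proof.
move=> [_ [s [g [<- [sm rs _ ng gs]]]]]; have hG := in_ideal_gen_ideal G.
split.
  rewrite -[size s]addn0; apply: depth_ge_regular => //.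
  by move=> f /sm [].
rewrite -addn1 => /(depth_ge_adjoins hG rs) /(depth_ge1 _ (adjoins_ideal s hG)) h.
by apply/ng/h => _ /mem_vars [i ->]; exact: gs.
Qed.

Lemma exact_depth_exists G : (forall f, G f -> irrelevant f) ->
  exact_depth setT G (depth (quot_gen G)).
Proof.
move=> GM; have hG := in_ideal_gen_ideal G.
have [h1 h2] := depth_geP GM.
have inT f : poly_in [set: 'I_r] f by move=> m _ i _; rewrite inE.
have [s [ss sm rs]] := regular_sequence_of_depth_ge hG h1.
split=> [f _|]; first exact: inT.
apply: contrapT => nsg; apply: h2; rewrite -addn1 -ss.
apply: depth_ge_regular => //; apply/depth_ge1; first exact: adjoins_ideal.
move=> g gs; apply: contrapT => ng; apply: nsg; exists s, g; split=> //; split=> //.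
  by move=> f /sm fm; split.
by move=> i _; apply: gs; apply/mem_vars; exists i.
Qed.

End DepthData.

Section Renaming.
Variables (K : fieldType) (a b : nat) (iota : 'I_a -> 'I_b) (iotaI : injective iota).
Local Notation Sa := {mpoly K[a]}.
Local Notation Sb := {mpoly K[b]}.
Local Open Scope ring_scope.

Definition rename : Sa -> Sb := mmap (mpolyC b (R := K)) (fun i => 'X_(iota i)).

HB.instance Definition _ := GRing.RMorphism.on rename.

Let unrename : Sb -> {mpoly Sa[b]} :=
  mmap (mpolyC b (R := Sa) \o mpolyC a (R := K))
    (fun j => if [pick i | iota i == j] is Some i then ('X_i)%:MP else 'X_j).

HB.instance Definition _ := GRing.RMorphism.on unrename.

Let reassemble : {mpoly Sa[b]} -> Sb := mmap rename (fun j => 'X_j).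

HB.instance Definition _ := GRing.RMorphism.on reassemble.

Lemma mpoly_rmorphism_ext (n : nat) (R : comNzRingType) (f g : {rmorphism {mpoly K[n]} -> R}) :
  (forall c, f c%:MP = g c%:MP) -> (forall i, f 'X_i = g 'X_i) -> f =1 g.
Proof.
move=> fgC fgX p; rewrite [p]mpolyE !rmorph_sum; apply: eq_bigr => m _.
rewrite -mul_mpolyC !rmorphM fgC mpolyXE_id !rmorph_prod; congr (_ * _).
by apply: eq_bigr => i _; rewrite !rmorphXn fgX.
Qed.

Lemma renameX i : rename 'X_i = 'X_(iota i).
Proof. by rewrite /rename mmapX mmap1U. Qed.

Lemma renameC c : rename c%:MP = c%:MP.
Proof. exact: mmapC. Qed.

Lemma unrename_rename p : unrename (rename p) = p%:MP.
Proof.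
apply: (mpoly_rmorphism_ext (f := unrename \o rename) (g := mpolyC b (R := Sa))) => [c|i] /=.
  by rewrite renameC /unrename mmapC.
rewrite renameX /unrename mmapX mmap1U.
by case: pickP => [j /eqP /iotaI ->//|/(_ i)]; rewrite eqxx.
Qed.

Lemma reassemble_unrename p : reassemble (unrename p) = p.
Proof.
apply: (mpoly_rmorphism_ext (f := reassemble \o unrename) (g := idfun)) => [c|j] /=.
  rewrite /unrename mmapC /= /reassemble mmapC; exact: renameC.
rewrite /unrename mmapX mmap1U.
case: pickP => [i /eqP <-|_]; first by rewrite /reassemble mmapC; exact: renameX.
by rewrite /reassemble mmapX mmap1U.
Qed.

Lemma poly_in_rename p : poly_in (iota @: setT) (rename p).
Proof.
rewrite /rename /mmap; apply: big_ind => [||m _]; [exact: poly_in0|exact: poly_inD|].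
rewrite mul_mpolyC; apply: poly_inZ; rewrite /mmap1.
apply: big_ind => [||i _]; [exact: poly_in1|exact: poly_inM|].
elim: (m i) => [|k IHk]; first by rewrite expr0; exact: poly_in1.
by rewrite exprS; apply: poly_inM => //; apply: poly_inXU; exact: imset_f.
Qed.

(** The generators of the extension of the ideal (G) along the inclusion of
    polynomial rings. *)
Definition rename_gens (G : Sa -> Prop) : Sb -> Prop := fun f => exists2 g, G g & f = rename g.

Lemma rename_ideal_sub G g : in_ideal_gen G g -> in_ideal_gen (rename_gens G) (rename g).
Proof.
move: g; apply: in_ideal_gen_min; last by move=> g Gg; apply: in_ideal_gen_mem; exists g.
have hG := in_ideal_gen_ideal (rename_gens G).
split=> [|f g|c f]; rewrite ?rmorph0 ?rmorphD ?rmorphM; [exact: ideal0|exact: idealD|].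
exact: idealM.
Qed.

(** The larger polynomial ring is free over the smaller one, with the
    monomials in the remaining variables as a basis. *)
Lemma rename_idealP G u :
  in_ideal_gen (rename_gens G) u <-> forall m, in_ideal_gen G (unrename u)@_m.
Proof.
have hG := in_ideal_gen_ideal G.
split=> [|h].
  move: u; apply: in_ideal_gen_min.
    split=> [m|f g hf hg m|c f hf m].
    - by rewrite (rmorph0 unrename) mcoeff0; exact: (ideal0 hG).
    - by rewrite (rmorphD unrename) mcoeffD; exact: (idealD hG (hf m) (hg m)).
    - rewrite (rmorphM unrename) mcoeffM; apply: (ideal_sum hG) => k _.
      exact: (idealM hG _ (hf _)).
  move=> _ [g Gg ->] m; rewrite unrename_rename mcoeffC.
  by apply: (ideal_mulr hG); exact: in_ideal_gen_mem.
rewrite -[u]reassemble_unrename /reassemble /mmap.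
apply: ideal_sum => [|m _]; first exact: in_ideal_gen_ideal.
by apply: (ideal_mulr (in_ideal_gen_ideal _)); exact: rename_ideal_sub.
Qed.

Lemma rename_ideal G g : in_ideal_gen (rename_gens G) (rename g) <-> in_ideal_gen G g.
Proof.
split; last exact: rename_ideal_sub.
by move=> /rename_idealP /(_ 0%MM); rewrite unrename_rename mcoeffC eqxx mulr1.
Qed.

Lemma adjoins_rename G s : adjoins (in_ideal_gen (rename_gens G)) (map rename s) =
  in_ideal_gen (rename_gens (fun f => G f \/ f \in s)).
Proof.
rewrite adjoins_gen; congr in_ideal_gen; apply/funext => f; apply/propext; split.
  case=> [[g Gg ->]|/mapP [g gs ->]]; first by exists g => //; left.
  by exists g => //; right.
by case=> g [Gg|gs] ->; [left; exists g|right; exact: map_f].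
Qed.

Lemma regular_rename G s : regular (in_ideal_gen G) s ->
  regular (in_ideal_gen (rename_gens G)) (map rename s).
Proof.
elim: s G => [|f s IHs] G //= [rf rs]; split.
  move=> g /rename_idealP h; apply/rename_idealP => m.
  by apply: rf; move: (h m); rewrite rmorphM /= unrename_rename mcoeffCM.
have := adjoins_rename G [:: f]; rewrite /= => ->.
rewrite (_ : (fun _ => _) = (fun g => G g \/ g = f)).
  by apply: IHs; rewrite -adjoin_gen.
apply/funext => g; apply/propext; rewrite inE.
by split=> [[|/eqP]|[|->]]; try tauto; rewrite eqxx; right.
Qed.

Lemma exact_depth_rename G k :
  exact_depth setT G k -> exact_depth (iota @: setT) (rename_gens G) k.
Proof.
move=> [_ [s [g [<- [sm rs _ ng gs]]]]]; split=> [_ [f _ ->]|]; first exact: poly_in_rename.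
exists (map rename s), (rename g); split; first by rewrite size_map.
split.
- move=> _ /mapP [f /sm [_ fm] ->]; split; first exact: poly_in_rename.
  move: f fm; apply: in_ideal_gen_min.
    have hm := irrelevant_ideal K b.
    split=> [|f f'|c f]; rewrite ?rmorph0 ?rmorphD ?rmorphM; [exact: ideal0|exact: idealD|].
    exact: idealM.
  move=> _ /mem_vars [i ->]; rewrite renameX; apply: in_ideal_gen_mem.
  by apply/mem_vars; exists (iota i).
- exact: regular_rename.
- exact: poly_in_rename.
- by rewrite adjoins_rename rename_ideal -adjoins_gen.
- move=> _ /imsetP [i _ ->]; rewrite -renameX -rmorphM adjoins_rename rename_ideal.
  by rewrite -adjoins_gen; exact: gs.
Qed.

End Renaming.

(** * Variables, and the ideal generated by the edges alone *)

Section VariableIdeals.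
Variables (K : fieldType) (r : nat).
Local Notation S := {mpoly K[r]}.
Local Open Scope ring_scope.
Implicit Types (X : {set 'I_r}) (f g : S) (G : S -> Prop) (m : 'X_{1..r}).

Lemma ideal_monomial_mul (J : S -> Prop) e m : is_ideal J -> J 'X_[e] -> (e <= m)%MM -> J 'X_[m].
Proof. by move=> hJ je em; rewrite -(submK em) mpolyXD; exact: idealM. Qed.

Lemma ideal_by_monomials (J : S -> Prop) f : is_ideal J ->
  (forall m, m \in msupp f -> J 'X_[m]) -> J f.
Proof.
move=> hJ h; rewrite [f]mpolyE big_seq; apply: (ideal_sum hJ) => m mf.
by rewrite -mul_mpolyC; apply: (idealM hJ); exact: h.
Qed.

Lemma msupp_mulX i f m : m \in msupp f -> (U_(i) + m)%MM \in msupp ('X_i * f).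
Proof. by rewrite !mcoeff_msupp mulrC mcoeffMX. Qed.

Lemma mulX_neq0 i f : 'X_i * f = 0 -> f = 0.
Proof.
move=> h; apply/mpolyP => m; rewrite mcoeff0 -(mcoeffMX f U_(i) m) mulrC h.
exact: mcoeff0.
Qed.

Lemma regular_variable i G : (forall f, G f -> poly_in (~: [set i]) f) ->
  forall g, in_ideal_gen G ('X_i * g) -> in_ideal_gen G g.
Proof.
move=> GX g; have e : in_ideal_gen G = in_ideal_gen (fun f => False \/ G f).
  by apply: in_ideal_gen_eq => f h; apply: in_ideal_gen_mem; tauto.
rewrite e; apply: (regular_tensor (X := [set i])) => //.
  by apply: poly_inXU; rewrite inE.
have zero_ideal : is_ideal (fun f : S => f = 0).
  by split=> [//|f f' -> ->|a f ->]; rewrite ?addr0 ?mulr0.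
move=> f /(in_ideal_gen_min zero_ideal) h; rewrite (mulX_neq0 (h _)) //.
exact: (ideal0 (in_ideal_gen_ideal _)).
Qed.

(** The variables zs do not occur in G, so that S/(G) is a polynomial ring in
    them. *)
Lemma regular_variables (zs : seq 'I_r) G : uniq zs ->
    (forall f, G f -> poly_in (~: [set:: zs]) f) ->
  regular (in_ideal_gen G) [seq 'X_i | i <- zs].
Proof.
elim: zs G => [|z zs IHzs] G //= /andP [nz uz] GX; split.
  apply: regular_variable => f /GX; apply: poly_in_sub.
  by apply/subsetP => i; rewrite !inE negb_or => /andP [].
rewrite adjoin_gen; apply: IHzs => // f [/GX|->].
  apply: poly_in_sub; apply/subsetP => i; rewrite !inE negb_or.
  by case/andP.
by apply: poly_inXU; rewrite !inE.
Qed.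

Lemma exact_depth_variables X : exact_depth X (fun f : S => exists2 i, i \in X & f = 'X_i) 0.
Proof.
split=> [f [i iX ->]|]; first exact: poly_inXU.
exists [::], 1; split=> //; split=> //=; first exact: poly_in1.
  move=> h; apply: (@not_irrelevant1 K r); apply: in_ideal_gen_min h.
    exact: irrelevant_ideal.
  move=> f [i _ ->]; apply: in_ideal_gen_mem; apply/mem_vars.
  by exists i.
move=> i iX; rewrite mulr1; apply: in_ideal_gen_mem.
by exists i.
Qed.

Lemma exact_depth_free (i : 'I_r) : exact_depth (K := K) [set i] (fun=> False) 1.
Proof.
split=> //; exists [:: 'X_i], 1; split=> //.
have Xirr : irrelevant ('X_i : S) by apply/in_ideal_gen_mem/mem_vars; exists i.
split=> [f||||j].
- by rewrite inE => /eqP ->; split=> //; apply: poly_inXU; rewrite inE.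
- by apply: (@regular_variables [:: i]).
- exact: poly_in1.
- move=> /adjoins_irrelevant h; apply: (@not_irrelevant1 K r); apply: h.
    by apply: in_ideal_gen_min => //; exact: irrelevant_ideal.
  by move=> f; rewrite inE => /eqP ->.
- rewrite inE mulr1 => /eqP ->; apply: adjoin_mem.
  exact: in_ideal_gen_ideal.
Qed.

End VariableIdeals.

Section EdgeDepth.
Variables (K : fieldType) (H : sgraph).
Local Notation S := {mpoly K[#|H|]}.
Local Open Scope ring_scope.
Local Notation pos x := (enum_rank (x : H)).

Definition plain_edge_gens (f : S) : Prop :=
  exists x y : H, edge x y /\ f = var K x * var K y.

Lemma var_mulE (x y : H) : var K x * var K y = 'X_[U_(pos x) + U_(pos y)].
Proof. by rewrite mpolyXD. Qed.

Lemma var_irrelevant (x : H) : irrelevant (var K x).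
Proof. by apply/in_ideal_gen_mem/mem_vars; exists (pos x). Qed.

Lemma edge_gens_irrelevant (f : S) : edge_gens f -> irrelevant f.
Proof.
have hm := irrelevant_ideal K #|H|.
case=> [[x [y [_ ->]]]|[x [_ ->]]]; last exact: var_irrelevant.
by apply: (idealM hm); exact: var_irrelevant.
Qed.

Lemma edge_neq (x y : H) : edge x y -> x != y.
Proof. by move=> exy; apply/eqP => e; move: exy; rewrite e edge_irr. Qed.

Lemma edge_monomial_le (x y : H) m : x != y ->
  (U_(pos x) + U_(pos y) <= m)%MM = (m (pos x) != 0%N) && (m (pos y) != 0%N).
Proof.
move=> xy; apply/mnm_lepP/andP => [h|[hx hy] i].
  have hx := h (pos x); have hy := h (pos y); rewrite !mnmDE !mnm1E !eqxx in hx hy.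
  by rewrite -!lt0n; split; [apply: leq_trans hx|apply: leq_trans hy; rewrite addnC].
rewrite mnmDE !mnm1E; have [<-|_] := eqVneq (pos x) i.
  by rewrite (inj_eq enum_rank_inj) eq_sym (negbTE xy) addn0 lt0n.
by have [<-|//] := eqVneq (pos y) i; rewrite lt0n.
Qed.

(** The isolated vertices form a regular sequence modulo the plain edge ideal,
    and adjoining them gives the edge ideal. *)
Lemma exact_depth_plain :
  exact_depth setT plain_edge_gens (#|isolated H| + edge_depth K H).
Proof.
have [_ [s [g [ss [sm rs _ ng gs]]]]] := exact_depth_exists edge_gens_irrelevant.
have inT (f : S) : poly_in [set: 'I_#|H|] f by move=> m _ i _; rewrite inE.
pose zs := [seq pos x | x <- enum (isolated H)].
have adjE : adjoins (in_ideal_gen plain_edge_gens) [seq 'X_i | i <- zs] =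
    in_ideal_gen (@edge_gens K H).
  rewrite adjoins_gen; apply: in_ideal_gen_eq => f.
    case=> [hf|/mapP [_ /mapP [x xi ->] ->]]; apply: in_ideal_gen_mem; first by left.
    by right; exists x; rewrite -(mem_enum (isolated H)).
  case=> [hf|[x [xi ->]]]; apply: in_ideal_gen_mem; first by left.
  by right; apply/map_f/map_f; rewrite mem_enum.
split=> [f _|]; first exact: inT.
exists ([seq 'X_i | i <- zs] ++ s), g; split.
  by rewrite size_cat !size_map -cardE ss.
split.
- move=> f; rewrite mem_cat => /orP [/mapP [i _ ->]|/sm [_ fm]]; split=> //.
  by apply/in_ideal_gen_mem/mem_vars; exists i.
- apply/regular_cat; rewrite adjE; split=> //; apply: regular_variables.
    by rewrite map_inj_uniq ?enum_uniq //; exact: enum_rank_inj.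
  have edge_out x y : edge x y -> pos x \in ~: [set:: zs].
    move=> exy; rewrite !inE (mem_map enum_rank_inj) mem_enum inE.
    by apply/forallPn; exists y; rewrite negbK.
  move=> f [x [y [exy ->]]]; apply: poly_inM; apply: poly_inXU.
    exact: edge_out exy.
  by apply: (edge_out y x); rewrite edge_sym.
- exact: inT.
- by rewrite adjoins_cat adjE.
- by move=> i iX; rewrite adjoins_cat adjE; exact: gs.
Qed.

Lemma plain_edge_monomials :
  plain_edge_gens = monomials (fun m => exists x y : H, edge x y /\ m = (U_(pos x) + U_(pos y))%MM).
Proof.
apply/funext => f; apply/propext; split.
  move=> [x [y [exy ->]]]; exists (U_(pos x) + U_(pos y))%MM; last exact: var_mulE.
  by exists x, y.
by move=> [_ [x [y [exy ->]]] ->]; exists x, y; rewrite var_mulE.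
Qed.

(** Depth zero would give a socle element g, hence a standard monomial m all
    of whose multiples by a variable are non-standard.  Multiplying by a
    variable v in the support of m (any v if m = 1) does not change whether an
    edge divides. *)
Lemma plain_depth_gt0 k : (0 < #|H|)%N -> exact_depth setT plain_edge_gens k -> (0 < k)%N.
Proof.
move=> H0 [_ [s [g [<-]]]]; case: s => [|f s] //= [_ _ _ /= ng gs].
exfalso; apply: ng.
rewrite plain_edge_monomials; apply/monomial_idealP => m mg.
suff [v hv] : exists v, forall x : H, (U_(pos v) + m)%MM (pos x) != 0%N ->
    m (pos x) != 0%N \/ (m = 0%MM /\ x = v).
  have := gs (pos v) (in_setT _); rewrite plain_edge_monomials.
  move=> /monomial_idealP /(_ _ (msupp_mulX (pos v) mg)) [_ [x [y [exy ->]]]].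
  have xy := edge_neq exy.
  rewrite edge_monomial_le // => /andP [/hv hx /hv hy].
  exists (U_(pos x) + U_(pos y))%MM; first by exists x, y.
  rewrite edge_monomial_le //.
  case: hx hy => [hx|[m0 xv]] [hy|[m0' yv]].
  - by rewrite hx.
  - by move: hx; rewrite m0' mnm0E.
  - by move: hy; rewrite m0 mnm0E.
  - by rewrite xv yv eqxx in xy.
have [m0|m0] := eqVneq m 0%MM.
  have [v _] := card_gt0P H0; exists v => x; rewrite m0 mnmDE mnm1E mnm0E addn0.
  by have [/enum_rank_inj ->|] := eqVneq (pos v) (pos x); [right|].
have [i mi] : exists i, m i != 0%N.
  apply: contrapT => ni; case/eqP: m0; apply/mnmP => i; rewrite mnm0E; apply/eqP.
  by apply: contrapT => mi; apply: ni; exists i; apply/negP.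
exists (enum_val i) => x; rewrite mnmDE mnm1E enum_valK.
by have [<-|] := eqVneq i (pos x); left.
Qed.

End EdgeDepth.

(** * Depth of the edge ring of the corona *)

Section CoronaDepth.
Variables (K : fieldType) (n : nat) (H : sgraph).
Hypothesis H0 : (0 < #|H|)%N.
Local Notation G := (corona (complete n) H).
Local Notation S := {mpoly K[#|G|]}.
Local Open Scope ring_scope.

Definition hub (i : 'I_n) : G := inl i.
Definition leaf (j : 'I_n) (h : H) : G := inr (j, h).

Local Notation pos v := (enum_rank (v : G)).

Definition copy (j : 'I_n) (a : 'I_#|H|) : 'I_#|G| := pos (leaf j (enum_val a)).

Lemma copy_inj j : injective (copy j).
Proof. by move=> a a' /enum_rank_inj [] /enum_val_inj. Qed.

Definition leaf_set (j : 'I_n) : {set 'I_#|G|} := copy j @: setT.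

Definition copy_gens (j : 'I_n) : S -> Prop :=
  rename_gens (K := K) (copy j) (@plain_edge_gens K H).

Lemma copy_gensP j f : copy_gens j f <->
  exists x y : H, edge x y /\ f = var K (leaf j x) * var K (leaf j y).
Proof.
have renE x y : rename (copy j) (var K x * var K y) = var K (leaf j x) * var K (leaf j y).
  by rewrite rmorphM; congr (_ * _); apply: etrans (renameX _ _ _) _; rewrite /copy enum_rankK.
split=> [[_ [x [y [exy ->]]] ->]|[x [y [exy ->]]]]; first by exists x, y.
by exists (var K x * var K y); [exists x, y|].
Qed.

Lemma leaf_setP j (v : G) : (pos v \in leaf_set j) = if v is inr (j', _) then j' == j else false.
Proof.
apply/imsetP; case: v => [i|[j' h]] /=.
  by case=> a _ /enum_rank_inj.
case: eqP => [->|ne].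
  by exists (enum_rank h); rewrite ?inE // /copy enum_rankK.
by case=> a _ /enum_rank_inj [].
Qed.

(** The variables of the corona fall into n pieces, one hub with its leaves
    each; apart from edges between hubs, the ideals below are sums of ideals
    in the separate pieces. *)
Definition piece (j : 'I_n) : {set 'I_#|G|} := pos (hub j) |: leaf_set j.

Lemma pieceP j (v : G) :
  (pos v \in piece j) = (match v with inl i => i | inr (i, _) => i end == j).
Proof.
rewrite in_setU1 leaf_setP (inj_eq enum_rank_inj).
by case: v => [i|[i h]] //=; rewrite orbF.
Qed.

Lemma piece_disjoint i j : i != j -> [disjoint piece i & piece j].
Proof.
move=> ij; apply/pred0P => a /=; rewrite -[a]enum_valK !pieceP.
by apply: contraNF ij => /andP [/eqP <- /eqP <-].
Qed.

Lemma bigcup_piece : \bigcup_(j <- index_enum 'I_n) piece j = setT.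
Proof.
apply/setP => a; rewrite inE -[a]enum_valK.
pose j := match enum_val a with inl i => i | inr (i, _) => i end.
by apply/bigcupP; exists j => //; rewrite pieceP.
Qed.

Lemma hub_leaf_disjoint j : [disjoint [set pos (hub j)] & leaf_set j].
Proof. by rewrite disjoints1 leaf_setP. Qed.

(** Generators in the j-th piece of the colon ideal at the hub k. *)
Definition colon_gens (k j : 'I_n) (f : S) : Prop :=
  if j == k then exists2 a, a \in leaf_set j & f = 'X_a
  else f = var K (hub j) \/ copy_gens j f.

(** Generators in the j-th piece of the edge ideal enlarged by all hubs. *)
Definition hubless_gens (j : 'I_n) (f : S) : Prop := f = var K (hub j) \/ copy_gens j f.

Local Notation t := (#|isolated H| + edge_depth K H)%N.

Lemma exact_depth_hubless j : exact_depth (piece j) (hubless_gens j) t.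
Proof.
have h1 := exact_depth_variables K [set pos (hub j)].
have h2 := exact_depth_rename (@copy_inj j) (exact_depth_plain K H).
apply: exact_depth_ext (exact_depth_union (hub_leaf_disjoint j) h1 h2) => // f.
split=> [[[a]|]|[->|]]; rewrite /hubless_gens.
- by rewrite inE => /eqP -> ->; left.
- by right.
- by left; exists (pos (hub j)); rewrite ?inE.
- by right.
Qed.

Lemma exact_depth_colon k j :
  exact_depth (piece j) (colon_gens k j) (if j == k then 1 else t).
Proof.
have h1 := exact_depth_free K (pos (hub j)).
have h2 := exact_depth_variables K (leaf_set j).
rewrite /colon_gens; case: eqP => _; last exact: exact_depth_hubless.
apply: exact_depth_ext (exact_depth_union (hub_leaf_disjoint j) h1 h2) => // f.
by split=> [[]|]; [| |right].
Qed.

Lemma exact_depth_all_hubless :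
  exact_depth setT (fun f => exists j, hubless_gens j f) (n * t).
Proof.
apply: exact_depth_ext (exact_depth_bigcup (index_enum_uniq 'I_n) piece_disjoint
  (fun j _ => exact_depth_hubless j)).
- exact: bigcup_piece.
- by move=> f; split=> [[j _ h]|[j h]]; exists j => //; rewrite mem_index_enum.
- by rewrite sum_nat_const card_ord.
Qed.

Lemma exact_depth_all_colon k :
  exact_depth setT (fun f => exists j, colon_gens k j f) (1 + (n - 1) * t).
Proof.
apply: exact_depth_ext (exact_depth_bigcup (index_enum_uniq 'I_n) piece_disjoint
  (fun j _ => exact_depth_colon k j)).
- exact: bigcup_piece.
- by move=> f; split=> [[j _ h]|[j h]]; exists j => //; rewrite mem_index_enum.
rewrite (bigD1 k) //= eqxx; congr addn.
rewrite (eq_bigr (fun=> t)) => [|j /negbTE -> //].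
by rewrite sum_nat_const cardC1 card_ord subn1.
Qed.

Definition first_hubs_gens (k : nat) (f : S) : Prop :=
  edge_gens f \/ exists2 i : 'I_n, (i < k)%N & f = var K (hub i).

Let J k := in_ideal_gen (first_hubs_gens k).
Let hJ k : is_ideal (J k) := in_ideal_gen_ideal _.

Lemma first_hubs0 : J 0 = in_ideal_gen (@edge_gens K G).
Proof.
apply: in_ideal_gen_eq => f; last by move=> h; apply: in_ideal_gen_mem; left.
by case=> [h|[] //]; apply: in_ideal_gen_mem.
Qed.

Lemma first_hubsS (k : 'I_n) : adjoin (J k) (var K (hub k)) = J k.+1.
Proof.
rewrite adjoin_gen; apply: in_ideal_gen_eq => f.
  case=> [[h|[i ik ->]]|->]; apply: in_ideal_gen_mem; first by left.
    by right; exists i => //; exact: ltnW.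
  by right; exists k.
case=> [h|[i ik ->]]; apply: in_ideal_gen_mem; first by left; left.
move: ik; rewrite ltnS leq_eqVlt => /orP [/eqP/val_inj ->|ik]; first by right.
by left; right; exists i.
Qed.

Lemma corona_isolated : isolated G = set0.
Proof.
have [h _] := card_gt0P H0.
apply/setP => v; rewrite !inE; apply/negbTE/forallPn; case: v => [i|[i h']].
  by exists (leaf i h); rewrite negbK /= eqxx.
by exists (hub i); rewrite negbK /= eqxx.
Qed.

Lemma first_hubs_last : J n = in_ideal_gen (fun f => exists j, hubless_gens j f).
Proof.
have idl := in_ideal_gen_ideal (fun f : S => exists j, hubless_gens j f).
have hub_in j : in_ideal_gen (fun f => exists j, hubless_gens j f) (var K (hub j)).
  by apply: in_ideal_gen_mem; exists j; left.
apply: in_ideal_gen_eq => f.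
  case=> [[[[i|[i h]] [[j|[j h']] [/= e ->]]]|[v [+ _]]]|[i _ ->]] //.
  - exact: (idealM idl).
  - exact: (ideal_mulr idl).
  - exact: (idealM idl).
  - apply: in_ideal_gen_mem; exists i; right; apply/copy_gensP.
    by case/andP: e => /eqP <- e; exists h, h'.
  - by rewrite corona_isolated inE.
case=> j [->|/copy_gensP [x [y [exy ->]]]]; apply: in_ideal_gen_mem.
  by right; exists j.
by left; left; exists (leaf j x), (leaf j y); rewrite /= eqxx.
Qed.

Lemma first_hubs_monomials k : first_hubs_gens k = monomials (fun m =>
  (exists x y : G, edge x y /\ m = (U_(pos x) + U_(pos y))%MM)
  \/ exists2 i : 'I_n, (i < k)%N & m = U_(pos (hub i))%MM).
Proof.
apply/funext => f; apply/propext; split.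
  case=> [[[x [y [exy ->]]]|[v []]]|[i ik ->]].
  - by exists (U_(pos x) + U_(pos y))%MM; [left; exists x, y|exact: var_mulE].
  - by rewrite corona_isolated inE.
  - by exists U_(pos (hub i))%MM => //; right; exists i.
case=> _ [[x [y [exy ->]]]|[i ik ->]] ->; last by right; exists i.
by left; left; exists x, y; rewrite var_mulE.
Qed.

(** Every edge at the hub k puts its other end in the colon ideal; conversely,
    a generator of the ideal that divides x m, x being the hub k, either is
    not divisible by x, and then divides m, or gives such an other end
    dividing m. *)
Lemma first_hubs_colon (k : 'I_n) :
  colon (J k) (var K (hub k)) = in_ideal_gen (fun f => exists j, colon_gens k j f).
Proof.
have idl := in_ideal_gen_ideal (fun f : S => exists j, colon_gens k j f).
have edge_in (x y : G) : edge x y -> J k (var K x * var K y).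
  by move=> exy; apply: in_ideal_gen_mem; left; left; exists x, y.
apply/funext => f; apply/propext; split; last first.
  move: f; apply: in_ideal_gen_min; first exact: colon_ideal.
  move=> f [j]; rewrite /colon_gens /colon; case: eqVneq => [->|jk].
    case=> a; rewrite -[a]enum_valK leaf_setP => + ->.
    case E : (enum_val a) => [//|[i h]] /eqP e.
    by apply: edge_in; rewrite /= e.
  case=> [->|/copy_gensP [x [y [exy ->]]]].
    by apply: edge_in; rewrite /= /complete_rel eq_sym.
  by apply: (idealM (hJ k)); apply: edge_in; rewrite /= eqxx.
have hub_in i : i != k -> in_ideal_gen (fun f => exists j, colon_gens k j f) (var K (hub i)).
  by move=> ik; apply: in_ideal_gen_mem; exists i; rewrite /colon_gens (negbTE ik); left.
have leaf_in h : in_ideal_gen (fun f => exists j, colon_gens k j f) (var K (leaf k h)).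
  apply: in_ideal_gen_mem; exists k; rewrite /colon_gens eqxx.
  by exists (pos (leaf k h)) => //; rewrite leaf_setP /= eqxx.
move=> hf; apply: ideal_by_monomials => // m mf.
suff divides : forall v : G, v != hub k -> (U_(pos v) <= U_(pos (hub k)) + m)%MM ->
    (U_(pos v) <= m)%MM.
  move: hf; rewrite /colon /J first_hubs_monomials => /monomial_idealP.
  move=> /(_ _ (msupp_mulX _ mf)) [e [[x [y [exy ->]]]|[i ik ->]] le]; last first.
    have ik' : i != k by rewrite -val_eqE /= ltn_eqF.
    apply: (ideal_monomial_mul idl (hub_in i ik')).
    apply: divides => //; apply: contraNneq ik' => -[->]; exact: eqxx.
  have lex : (U_(pos x) <= U_(pos (hub k)) + m)%MM by apply: lepm_trans le; exact: lem_addr.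
  have ley : (U_(pos y) <= U_(pos (hub k)) + m)%MM by apply: lepm_trans le; exact: lem_addl.
  have hub_case i : i != k -> (U_(pos (hub i)) <= U_(pos (hub k)) + m)%MM ->
      in_ideal_gen (fun f => exists j, colon_gens k j f) 'X_[m].
    move=> ik li; apply: (ideal_monomial_mul idl (hub_in i ik)).
    apply: divides => //; apply: contraNneq ik => -[->]; exact: eqxx.
  have leaf_case h : (U_(pos (leaf k h)) <= U_(pos (hub k)) + m)%MM ->
      in_ideal_gen (fun f => exists j, colon_gens k j f) 'X_[m].
    by move=> li; apply: (ideal_monomial_mul idl (leaf_in h)); exact: divides.
  case: x y exy le lex ley => [i|[i h]] [j|[j h']] /= exy le lex ley.
  - have [ik|ik] := eqVneq i k; last exact: hub_case lex.
    by apply: hub_case ley; rewrite -ik eq_sym.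
  - have [ik|ik] := eqVneq i k; last exact: hub_case lex.
    by move/eqP: exy ley => <-; rewrite ik; exact: leaf_case.
  - have [jk|jk] := eqVneq j k; last exact: hub_case ley.
    by move/eqP: exy lex => ->; rewrite jk; exact: leaf_case.
  case/andP: exy => /eqP ij exy; subst j.
  have [ik|ik] := eqVneq i k; first by subst i; exact: leaf_case lex.
  apply: (ideal_monomial_mul (e := (U_(pos (leaf i h)) + U_(pos (leaf i h')))%MM) idl).
    apply: in_ideal_gen_mem; exists i; rewrite /colon_gens (negbTE ik); right.
    by apply/copy_gensP; exists h, h'; rewrite var_mulE.
  rewrite edge_monomial_le; last by apply: (edge_neq (H := G)); rewrite /= eqxx.
  by rewrite -!lep1mP !divides.
move=> v vk; rewrite !lep1mP mnmDE mnm1E (inj_eq enum_rank_inj).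
by rewrite (eq_sym (hub k)) (negbTE vk).
Qed.

Lemma corona_depth : (1 <= n)%N -> edge_depth K G = (1 + (n - 1) * (edge_depth K H + #|isolated H|))%N.
Proof.
move=> n1; rewrite [(edge_depth K H + _)%N]addnC; set d := (1 + _)%N.
have t0 : (0 < t)%N := plain_depth_gt0 H0 (exact_depth_plain K H).
have dle : (d <= n * t)%N.
  by rewrite /d -{2}(subnK n1) mulnDl mul1n addnC leq_add2l.
have hA (k : 'I_n) : depth_ge (vars K #|G|) (colon (J k) (var K (hub k))) d /\
    ~ depth_ge (vars K #|G|) (colon (J k) (var K (hub k))) d.+1.
  by rewrite first_hubs_colon; apply: exact_depth_total; exact: exact_depth_all_colon.
(* Descending induction on the number n - k of adjoined hubs. *)
have hge k : (k <= n)%N -> depth_ge (vars K #|G|) (J (n - k)) d.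
  elim: k => [|k IHk] kn.
    rewrite subn0 first_hubs_last; apply: depth_ge_leq dle _.
    by have [] := exact_depth_total exact_depth_all_hubless.
  have lt : (n - k.+1 < n)%N by rewrite ltn_subrL n1.
  have [hAk _] := hA (Ordinal lt).
  apply: (depth_ge_middle (hJ _) hAk); rewrite first_hubsS /= subnSK //.
  by apply: IHk; exact: ltnW.
have J0 := hge n (leqnn n); rewrite subnn in J0.
rewrite first_hubs0 in J0.
apply: (depth_eq (@edge_gens_irrelevant K G) J0) => J0'.
have [_] := hA (Ordinal n1); apply; apply: (depth_ge_left (hJ _)); first by rewrite /= first_hubs0.
rewrite first_hubsS /=; have := hge (n - 1)%N (leq_subr _ _).
by rewrite subKn.
Qed.

End CoronaDepth.

(** * Stanley decompositions as partitions of the standard monomials *)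

Section MonomialStanley.
Variables (K : fieldType) (r : nat) (G : {mpoly K[r]} -> Prop).
Local Notation S := {mpoly K[r]}.
Local Open Scope ring_scope.
Variable std : pred 'X_{1..r}.
Hypothesis stdP : forall f, in_ideal_gen G f <-> forall m, m \in msupp f -> ~~ std m.

(** The monomials of u K[X] for c = (u, X). *)
Definition cone (c : 'X_{1..r} * {set 'I_r}) (u : 'X_{1..r}) : bool :=
  [forall i, (c.1 i <= u i)%N && ((i \in c.2) || (u i == c.1 i))].

Lemma coneP (c : 'X_{1..r} * {set 'I_r}) (u : 'X_{1..r}) : reflect
  ((c.1 <= u)%MM /\ forall i, (u - c.1)%MM i != 0%N -> i \in c.2) (cone c u).
Proof.
apply: (iffP forallP) => [h|[le h] i].
  split=> [|i]; first by apply/mnm_lepP => i; have /andP [] := h i.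
  rewrite mnmBE subn_eq0 -ltnNge => lt; have /andP [_] := h i.
  by rewrite (gtn_eqF lt) orbF.
have lei := mnm_lepP le i; rewrite lei /=.
have [//|/= ni] := boolP (i \in c.2).
by move: ni; apply: contraNT => ne; apply: h; rewrite mnmBE subn_eq0 -ltnNge ltn_neqAle eq_sym ne.
Qed.

Lemma cone_add m (X : {set 'I_r}) (p : S) v : poly_in X p -> v \in msupp p ->
  cone (m, X) (v + m)%MM.
Proof.
move=> pX vp; apply/coneP; split; first exact: lem_addl.
by move=> i; rewrite addmK; exact: pX.
Qed.

Lemma mcoeff_mulX_cone m (X : {set 'I_r}) (p : S) u : poly_in X p -> ~~ cone (m, X) u ->
  (p * 'X_[m])@_u = 0.
Proof.
move=> pX; apply: contraNeq; rewrite -mcoeff_msupp.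
by move=> /msuppM_le /allpairsP [[v w] /= [vp]]; rewrite msuppX inE => /eqP -> ->; exact: cone_add pX vp.
Qed.

Lemma proj_eq0 f : proj G f = 0 <-> in_ideal_gen G f.
Proof.
have proj0 : proj G 0 = 0 by have := projB G 0 0; rewrite !subr0 subrr.
rewrite -proj0 proj_eq subr0; by split=> /asboolP.
Qed.

Lemma proj_sum (I : Type) (s : seq I) (F : I -> S) :
  proj G (\sum_(i <- s) F i) = \sum_(i <- s) proj G (F i).
Proof.
elim: s => [|i s IHs]; last by rewrite !big_cons projD IHs.
by rewrite !big_nil; apply/proj_eq0; exact: (ideal0 (in_ideal_gen_ideal _)).
Qed.

Lemma scale_proj (a f : S) : a *: proj G f = proj G (a * f).
Proof. exact: quot_scale_proj. Qed.

(** Multidegrees determine monomials, so homogeneous elements are multiples of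
    monomials. *)
Lemma homogeneous_monomial d (x : quot_gen G) : quot_component d x -> x <> 0 ->
  exists mc : 'X_{1..r} * K, mc.2 != 0 /\ x = proj G (mc.2 *: 'X_[mc.1]).
Proof.
move=> [f [fd ->]] f0; case E : (msupp f) => [|m s].
  by case: f0; rewrite (msuppnil0 E); apply/proj_eq0; exact: (ideal0 (in_ideal_gen_ideal _)).
have mf : m \in msupp f by rewrite E inE eqxx.
exists (m, f@_m); rewrite -mcoeff_msupp; split=> //=; congr proj.
apply/mpolyP => m'; rewrite mcoeffZ mcoeffX; have [<-|ne] := eqVneq m m'.
  by rewrite mulr1.
rewrite mulr0; apply/eqP; rewrite mcoeff_eq0; apply: contra ne => mf'.
apply/eqP/mnmP => i; apply/eqP.
by have := fd m mf i; rewrite -(fd m' mf' i) => -[->].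
Qed.

(** A standard monomial in no cone could not be spanned; two cones sharing a
    monomial would give a relation between their summands; freeness keeps the
    cones inside the set of standard monomials. *)
Lemma std_family_of_decomposition k (a : 'I_k -> quot_gen G) (X : 'I_k -> {set 'I_r}) :
    stanley_decomposition (@quot_component K r G) a X ->
  exists m : 'I_k -> 'X_{1..r}, forall u, (\sum_i cone (m i, X i) u)%N = std u.
Proof.
move=> [hom free spans indep].
have a0 i : a i <> 0.
  move=> ai0; have := free i 1 (@poly_in1 _ _ _); rewrite ai0 scaler0 => /(_ erefl).
  by move/eqP; rewrite oner_eq0.
have [mc mcP] : {mc : 'I_k -> 'X_{1..r} * K &
    forall i, (mc i).2 != 0 /\ a i = proj G ((mc i).2 *: 'X_[(mc i).1])}.
  apply: (@choice _ _ (fun i (mc : 'X_{1..r} * K) =>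
    mc.2 != 0 /\ a i = proj G (mc.2 *: 'X_[mc.1]))) => i.
  by have [d hd] := hom i; exact: homogeneous_monomial hd (a0 i).
pose m i := (mc i).1; exists m => u.
have coneX i : cone (m i, X i) u -> poly_in (X i) ('X_[(u - m i)] : S).
  by move=> /coneP [_ h]; exact: poly_inX.
have scaleX i p : p *: a i = proj G ((mc i).2 *: (p * 'X_[m i])).
  by have [_ ->] := mcP i; rewrite scale_proj scalerAr.
have coneXu i : cone (m i, X i) u -> 'X_[(u - m i)] * 'X_[m i] = 'X_[u] :> S.
  by move=> /coneP [le _]; rewrite -mpolyXD submK.
have X0 (w : 'X_{1..r}) : 'X_[w] <> 0 :> S.
  by move=> /(congr1 (mcoeff w)); rewrite mcoeffX eqxx mcoeff0 => /eqP; rewrite oner_eq0.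
have cone_std i : cone (m i, X i) u -> std u.
  move=> ci; apply: contrapT => /negP nstd; apply: (X0 (u - m i)%MM).
  apply: (free i _ (coneX i ci)); rewrite scaleX coneXu //.
  apply/proj_eq0/stdP => w /msuppZ_le; rewrite msuppX inE => /eqP ->.
  exact: nstd.
have cone_uniq i j : cone (m i, X i) u -> cone (m j, X j) u -> i = j.
  move=> ci cj; apply: contrapT => ij.
  pose p l : S := if l == i then (mc i).2^-1 *: 'X_[u - m i]
                  else if l == j then - ((mc j).2^-1 *: 'X_[u - m j]) else 0.
  have pX l : poly_in (X l) (p l).
    rewrite /p; case: eqP => [->|_]; first by apply: poly_inZ; exact: coneX.
    case: eqP => [->|_]; last exact: poly_in0.
    by apply/poly_inN/poly_inZ; exact: coneX.
  have pa l : cone (m l, X l) u -> ((mc l).2^-1 *: 'X_[u - m l]) *: a l = proj G 'X_[u].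
    move=> cl; rewrite scaleX -scalerAl coneXu // scalerA mulfV ?scale1r //.
    by have [] := mcP l.
  have ps : \sum_l p l *: a l = 0.
    rewrite (bigD1 i) //= (bigD1 j) /=; last by apply/eqP => /esym.
    rewrite big1 => [|l /andP [/negbTE li /negbTE lj]]; last by rewrite /p li lj scale0r.
    rewrite addr0 /p eqxx (introF eqP (fun e => ij (esym e))) eqxx.
    by rewrite scaleNr !pa // subrr.
  have := indep p pX ps i; rewrite /p eqxx pa // => /proj_eq0/stdP /(_ u).
  by rewrite msuppX inE eqxx (cone_std i ci) => /(_ isT).
have [su|nsu] := boolP (std u); last first.
  by apply: big1 => i _; case: (boolP (cone _ u)) nsu => // /cone_std ->.
suff [i ci] : exists i, cone (m i, X i) u.
  rewrite (bigD1 i) //= ci big1 // => j ji; case: (boolP (cone (m j, X j) u)) => // cj.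
  by rewrite (cone_uniq j i cj ci) eqxx in ji.
apply: contrapT => nc; have [p [pX /esym]] := spans (proj G 'X_[u]).
rewrite (eq_bigr (fun i => proj G ((mc i).2 *: (p i * 'X_[m i])))) => [|i _]; last exact: scaleX.
rewrite -proj_sum => /esym/proj_eq/asboolP /stdP /(_ u); rewrite su /= => h.
have {h} : u \notin msupp ('X_[u] - \sum_i (mc i).2 *: (p i * 'X_[m i])) by apply/negP => /h.
rewrite -mcoeff_eq0 mcoeffB mcoeffX eqxx (raddf_sum (mcoeff u)) /= big1 ?subr0 ?oner_eq0 //.
move=> i _; rewrite mcoeffZ (mcoeff_mulX_cone (pX i)) ?mulr0 //.
by apply/negP => ci; apply: nc; exists i.
Qed.

Lemma decomposition_of_std_family k (m : 'I_k -> 'X_{1..r}) (X : 'I_k -> {set 'I_r}) :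
    (forall u, (\sum_i cone (m i, X i) u)%N = std u) ->
  stanley_decomposition (@quot_component K r G) (fun i => proj G 'X_[m i]) X.
Proof.
move=> part.
have cone_std i u : cone (m i, X i) u -> std u.
  by move=> ci; have := part u; rewrite (bigD1 i) //= ci; case: (std u).
have cone_uniq i j u : cone (m i, X i) u -> j != i -> ~~ cone (m j, X j) u.
  move=> ci ji; apply/negP => cj; have := part u.
  rewrite (bigD1 i) //= (bigD1 j) //= ci cj; by case: (std u).
have indep (p : 'I_k -> S) : (forall i, poly_in (X i) (p i)) ->
    in_ideal_gen G (\sum_i p i * 'X_[m i]) -> forall i, p i = 0.
  move=> pX /stdP h i; apply/mpolyP => v; rewrite mcoeff0; apply/eqP.
  rewrite mcoeff_eq0; apply/negP => vp.
  have ci := cone_add (m i) (pX i) vp.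
  have : (v + m i)%MM \notin msupp (\sum_i p i * 'X_[m i]).
    by apply/negP => /h; rewrite (cone_std _ _ ci).
  rewrite -mcoeff_eq0 (raddf_sum (mcoeff _)) /= (bigD1 i) //= big1 => [|j ji].
    by rewrite addr0 addmC mcoeffMX mcoeff_eq0 vp.
  by apply: mcoeff_mulX_cone => //; exact: cone_uniq ci ji.
split.
- move=> i; exists (fun j => (m i j)%:Z), 'X_[m i]; split=> // u.
  by rewrite msuppX inE => /eqP ->.
- move=> i p pX; rewrite scale_proj => /proj_eq0 hp.
  pose q j := if j == i then p else 0.
  have <- : q i = p by rewrite /q eqxx.
  apply: (indep q) => [j|]; first by rewrite /q; case: eqP => [->//|_]; exact: poly_in0.
  rewrite (bigD1 i) //= big1 => [|j /negbTE ji]; last by rewrite /q ji mul0r.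
  by rewrite addr0 /q eqxx.
- move=> x; rewrite -[x]proj_repr; move: (repr _) => f.
  pose p i := \sum_(u <- msupp f | cone (m i, X i) u) f@_u *: ('X_[u - m i] : S).
  exists p; split.
    move=> i; apply: big_ind => [||u /coneP [_ h]]; [exact: poly_in0|exact: poly_inD|].
    by apply/poly_inZ/poly_inX.
  rewrite (eq_bigr (fun i => proj G (p i * 'X_[m i]))) => [|i _]; last exact: scale_proj.
  rewrite -proj_sum; apply/proj_eq/asboolP.
  have -> : \sum_i p i * 'X_[m i] = \sum_(u <- msupp f) (f@_u *: 'X_[u]) *+ std u.
    rewrite (eq_bigr (fun i => \sum_(u <- msupp f) (f@_u *: 'X_[u]) *+ cone (m i, X i) u)).
      rewrite exchange_big /=; apply: eq_bigr => u _.
      by rewrite -part -sumrMnr.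
    move=> i _; rewrite /p mulr_suml [LHS]big_mkcond; apply: eq_bigr => u _.
    by case: ifP => // /coneP [le _]; rewrite -scalerAl -mpolyXD submK.
  rewrite {1}[f]mpolyE -sumrB; apply: (ideal_sum (in_ideal_gen_ideal _)) => u _.
  apply/stdP => w; case: (boolP (std u)) => su; first by rewrite subrr msupp0.
  by rewrite subr0 => /msuppZ_le; rewrite msuppX inE => /eqP ->.
- move=> p pX; rewrite (eq_bigr (fun i => proj G (p i * 'X_[m i]))) => [|i _]; last exact: scale_proj.
  rewrite -proj_sum => /proj_eq0 /(indep p pX) p0 i.
  by rewrite p0 scale0r.
Qed.

(** Families over an arbitrary finite index type, filtered by a predicate:
    products of families are then indexed by functions. *)
Definition std_partition (I : finType) (P : pred I) (c : I -> 'X_{1..r} * {set 'I_r}) :=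
  forall u, (\sum_(i | P i) cone (c i) u)%N = std u.

Lemma decomposition_size_bound d :
    (exists k (a : 'I_k -> quot_gen G) (X : 'I_k -> {set 'I_r}),
      stanley_decomposition (@quot_component K r G) a X /\ sdepth_of_decomposition X d) ->
  (d <= r)%N.
Proof.
by move=> [k [a [X [_ [[i <-] _]]]]]; rewrite -[leqRHS]card_ord; exact: max_card.
Qed.

Lemma sdepth_ge_partition (I : finType) (P : pred I) (c : I -> 'X_{1..r} * {set 'I_r}) d u0 : std u0 ->
    std_partition P c -> (forall i, P i -> (d <= #|(c i).2|)%N) ->
  exists k (a : 'I_k -> quot_gen G) (X : 'I_k -> {set 'I_r}) d',
    [/\ stanley_decomposition (@quot_component K r G) a X, sdepth_of_decomposition X d'
      & (d <= d')%N].
Proof.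
move=> su0 part dc; pose ci (j : 'I_#|P|) := c (enum_val j).
have hpart u : (\sum_j cone ((ci j).1, (ci j).2) u)%N = std u.
  rewrite -part (big_enum_val (A := P) (fun i => nat_of_bool (cone (c i) u))).
  by apply: eq_bigr => j _; rewrite -surjective_pairing.
have := part u0; rewrite su0 => h0.
have [i0 Pi0] : exists i0, P i0.
  apply: contrapT => nP; move: h0; rewrite big_pred0 // => i.
  by apply/negP => Pi; apply: nP; exists i.
have j0 : 'I_#|P| by exact: (enum_rank_in Pi0 i0).
case: (arg_minnP (fun j => #|(ci j).2|) (erefl (xpredT j0))) => j _ minj.
exists #|P|, (fun j => proj G 'X_[(ci j).1]), (fun j => (ci j).2), #|(ci j).2|.
split; first exact: decomposition_of_std_family.
  by split=> [|i]; [exists j|exact: minj].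
by apply: dc; exact: enum_valP.
Qed.

Lemma sdepth_ge (I : finType) (P : pred I) (c : I -> 'X_{1..r} * {set 'I_r}) d u0 : std u0 ->
    std_partition P c -> (forall i, P i -> (d <= #|(c i).2|)%N) ->
  (d <= sdepth G)%N.
Proof.
move=> su0 part dc.
have [k [a [X [d' [dec sd dd']]]]] := sdepth_ge_partition su0 part dc.
apply: leq_trans dd' _.
have [||d'' P'' max''] := @ex_nat_max (fun d => exists k (a : 'I_k -> quot_gen G)
    (X : 'I_k -> {set 'I_r}),
    stanley_decomposition (@quot_component K r G) a X /\ sdepth_of_decomposition X d) r.
- by exists d', k, a, X.
- by move=> d1; exact: decomposition_size_bound.
rewrite /sdepth /sdepth_graded (nat_max_eq P'' max''); apply: max''.
by exists k, a, X.
Qed.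

Lemma sdepth_attained (I : finType) (P : pred I) (c : I -> 'X_{1..r} * {set 'I_r}) u0 : std u0 -> std_partition P c ->
  exists k (c' : 'I_k -> 'X_{1..r} * {set 'I_r}),
    std_partition xpredT c' /\ forall i, (sdepth G <= #|(c' i).2|)%N.
Proof.
move=> su0 part.
have [//|k [a [X [d' [dec sd _]]]]] := @sdepth_ge_partition _ _ _ 0 _ su0 part.
have [||d'' P'' max''] := @ex_nat_max (fun d => exists k (a : 'I_k -> quot_gen G)
    (X : 'I_k -> {set 'I_r}),
    stanley_decomposition (@quot_component K r G) a X /\ sdepth_of_decomposition X d) r.
- by exists d', k, a, X.
- by move=> d1; exact: decomposition_size_bound.
rewrite /sdepth /sdepth_graded (nat_max_eq P'' max'').
have [k' [a' [X' [dec' [_ leX]]]]] := P''.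
have [m hm] := std_family_of_decomposition dec'.
by exists k', (fun i => (m i, X' i)); split.
Qed.

Lemma sdepth_le b :
    (forall k (c : 'I_k -> 'X_{1..r} * {set 'I_r}),
      std_partition xpredT c -> exists i, (#|(c i).2| <= b)%N) ->
  (sdepth G <= b)%N.
Proof.
move=> hb; rewrite /sdepth /sdepth_graded /nat_max; case: pselect => // h.
case: (cid h) => /= d [[k [a [X [dec [_ leX]]]]] _].
have [m hm] := std_family_of_decomposition dec.
have [i /= le] := hb k (fun i => (m i, X i)) hm.
exact: leq_trans (leX i) le.
Qed.

End MonomialStanley.

(** * Partitions of exponent vectors on the vertices of a graph *)

Section ExponentCones.
Variable V : finType.
Implicit Types (u e : {ffun V -> nat}) (X : {set V}) (c : {ffun V -> nat} * {set V}).

Definition vcone (c : {ffun V -> nat} * {set V}) u : bool :=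
  [forall x, (c.1 x <= u x) && ((x \in c.2) || (u x == c.1 x))].

Definition vpartition (std : pred {ffun V -> nat}) (I : finType) (P : pred I)
    (c : I -> {ffun V -> nat} * {set V}) :=
  forall u, \sum_(i | P i) vcone (c i) u = std u.

Definition ones X : {ffun V -> nat} := [ffun x => (x \in X) : nat].
Definition vsupp u : {set V} := [set x | u x != 0].

Lemma vcone_base c : vcone c c.1.
Proof. by apply/forallP => x; rewrite leqnn eqxx orbT. Qed.

Lemma vcone_mono c u y : vcone c u -> y \in c.2 -> vcone c [ffun x => u x + (x == y)].
Proof.
move=> /forallP cu yc; apply/forallP => x; have /andP [le h] := cu x.
rewrite ffunE (leq_trans le (leq_addr _ _)) /=.
by have [->|] := eqVneq x y; rewrite ?yc // addn0.
Qed.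

Lemma vpartition_std (std : pred {ffun V -> nat}) (I : finType) (P : pred I)
    (c : I -> {ffun V -> nat} * {set V}) i u :
  vpartition std P c -> P i -> vcone (c i) u -> std u.
Proof. by move=> part Pi ci; have := part u; rewrite (bigD1 i) //= ci; case: (std u). Qed.

Lemma vcone_ones X u : vcone (ones X, X) u = (vsupp u == X).
Proof.
apply/forallP/eqP => [h|<- x]; last first.
  by rewrite ffunE !inE; case: (u x).
apply/setP => x; have := h x; rewrite ffunE !inE /=; case: (x \in X) => /=.
  by rewrite lt0n andbT.
by move=> /eqP ->.
Qed.

Lemma vcone_line v u : vcone ([ffun=> 0], [set v]) u = (vsupp u \subset [set v]).
Proof.
apply/forallP/subsetP => h x; have := h x; rewrite ffunE !inE.
  by case: (x == v) => //= /eqP ->.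
by case: (x == v) => //=; case: (u x == 0) => // /(_ isT).
Qed.

End ExponentCones.

Section GraphPartitions.
Variables (K : fieldType) (G : sgraph).
Local Notation pos x := (enum_rank (x : G)).
Implicit Types (u : {ffun G -> nat}) (m : 'X_{1..#|G|}).

(** Exponents of the standard monomials of the plain edge ideal. *)
Definition plain_exponent u : bool :=
  [forall x, forall y, edge x y ==> (u x == 0) || (u y == 0)].

(** Exponents of the standard monomials of the edge ideal. *)
Definition edge_exponent u : bool :=
  plain_exponent u && [forall x in isolated G, u x == 0].

Lemma plain_exponentP u :
  reflect (forall x y, edge x y -> u x = 0 \/ u y = 0) (plain_exponent u).
Proof.
apply: (iffP 'forall_'forall_implyP) => h x y /h; first by case/orP => /eqP; auto.
by case=> ->; rewrite eqxx ?orbT.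
Qed.

Definition exponent m : {ffun G -> nat} := [ffun x => m (pos x)].
Definition multinom_of u : 'X_{1..#|G|} := [multinom u (enum_val i) | i < #|G|].

Lemma multinom_ofK : cancel multinom_of exponent.
Proof. by move=> u; apply/ffunP => x; rewrite ffunE mnmE enum_rankK. Qed.

Lemma edge_exponentP (f : {mpoly K[#|G|]}) :
  in_ideal_gen (@edge_gens K G) f <->
  forall m, m \in msupp f -> ~~ edge_exponent (exponent m).
Proof.
have -> : @edge_gens K G = monomials (fun m => (exists x y : G, edge x y /\ m = (U_(pos x) + U_(pos y))%MM)
    \/ exists2 x : G, x \in isolated G & m = U_(pos x)%MM).
  apply/funext => g; apply/propext; split.
    case=> [[x [y [exy ->]]]|[x [xi ->]]].
      by exists (U_(pos x) + U_(pos y))%MM; [left; exists x, y|exact: var_mulE].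
    by exists U_(pos x)%MM => //; right; exists x.
  case=> _ [[x [y [exy ->]]]|[x xi ->]] ->; last by right; exists x.
  by left; exists x, y; rewrite var_mulE.
rewrite monomial_idealP; split=> h m mf.
  have [e [[x [y [exy ->]]]|[x xi ->]]] := h m mf.
    rewrite edge_monomial_le; last exact: edge_neq.
    move=> /andP [mx my]; apply/negP => /andP [/plain_exponentP /(_ x y exy)].
    by rewrite !ffunE => -[] e0; rewrite e0 in mx my.
  rewrite lep1mP => mx; apply/negP => /andP [_ /forall_inP /(_ x xi)].
  by rewrite ffunE (negbTE mx).
have := h m mf; rewrite negb_and => /orP [] /forallPn [x].
  move=> /forallPn [y]; rewrite negb_imply !ffunE negb_or => /andP [exy /andP [mx my]].
  exists (U_(pos x) + U_(pos y))%MM; first by left; exists x, y.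
  by rewrite edge_monomial_le ?mx //; exact: edge_neq.
rewrite negb_imply ffunE => /andP [xi mx]; exists U_(pos x)%MM; first by right; exists x.
by rewrite lep1mP.
Qed.

Definition vcone_of (c : 'X_{1..#|G|} * {set 'I_#|G|}) : {ffun G -> nat} * {set G} :=
  (exponent c.1, [set x | pos x \in c.2]).
Definition cone_of (c : {ffun G -> nat} * {set G}) : 'X_{1..#|G|} * {set 'I_#|G|} :=
  (multinom_of c.1, [set pos x | x in c.2]).

Lemma cone_ofK : cancel cone_of vcone_of.
Proof.
case=> e X; rewrite /vcone_of /cone_of /= multinom_ofK; congr pair.
by apply/setP => x; rewrite inE (mem_imset _ _ enum_rank_inj).
Qed.

Lemma vcone_ofE c m : vcone (vcone_of c) (exponent m) = cone c m.
Proof.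
apply/forallP/forallP => h i; last by have := h (pos i); rewrite !ffunE inE.
by have := h (enum_val i); rewrite !ffunE inE enum_valK.
Qed.

Lemma card_cone_of c : #|(cone_of c).2| = #|c.2|.
Proof. by rewrite card_imset //; exact: enum_rank_inj. Qed.

Lemma card_vcone_of c : #|(vcone_of c).2| = #|c.2|.
Proof.
rewrite -card_cone_of; congr #|pred_of_set _|; apply/setP => i.
apply/imsetP/idP => [[x xc ->]|ic]; first by rewrite inE in xc.
by exists (enum_val i); rewrite ?inE enum_valK.
Qed.

Lemma edge_exponent0 : edge_exponent (exponent 0%MM).
Proof.
apply/andP; split; last by apply/forall_inP => x _; rewrite ffunE mnm0E.
by apply/plain_exponentP => x y _; rewrite ffunE mnm0E; left.
Qed.

Lemma cone_partition (I : finType) (P : pred I) 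
    (c : I -> {ffun G -> nat} * {set G}) : vpartition edge_exponent P c ->
  std_partition (fun m => edge_exponent (exponent m)) P (fun i => cone_of (c i)).
Proof.
move=> part m; rewrite -part; apply: eq_bigr => i _.
by rewrite -vcone_ofE cone_ofK.
Qed.

Lemma edge_sdepth_ge (I : finType) (P : pred I) 
    (c : I -> {ffun G -> nat} * {set G}) d :
    vpartition edge_exponent P c -> (forall i, P i -> d <= #|(c i).2|) ->
  d <= edge_sdepth K G.
Proof.
move=> part dc; apply: (sdepth_ge edge_exponentP edge_exponent0 (cone_partition part)).
by move=> i Pi; rewrite card_cone_of; exact: dc.
Qed.

Lemma edge_partition (I : finType) (P : pred I) (c : I -> 'X_{1..#|G|} * {set 'I_#|G|}) :
  std_partition (fun m => edge_exponent (exponent m)) P c ->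
  vpartition edge_exponent P (fun i => vcone_of (c i)).
Proof.
move=> part u; rewrite -[u]multinom_ofK -part; apply: eq_bigr => i _.
by rewrite vcone_ofE.
Qed.

Lemma edge_sdepth_attained (I : finType) (P : pred I) 
    (c : I -> {ffun G -> nat} * {set G}) : vpartition edge_exponent P c ->
  exists k (c' : 'I_k -> {ffun G -> nat} * {set G}),
    vpartition edge_exponent xpredT c' /\ forall i, edge_sdepth K G <= #|(c' i).2|.
Proof.
move=> /cone_partition /(sdepth_attained edge_exponentP edge_exponent0) [k [c' [part le]]].
exists k, (fun i => vcone_of (c' i)); split; first exact: edge_partition.
by move=> i; rewrite card_vcone_of.
Qed.

Lemma edge_sdepth_le b :
    (forall k (c : 'I_k -> {ffun G -> nat} * {set G}),
      vpartition edge_exponent xpredT c -> exists i, #|(c i).2| <= b) ->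
  edge_sdepth K G <= b.
Proof.
move=> hb; apply: (sdepth_le edge_exponentP) => k c /edge_partition /hb [i].
by rewrite card_vcone_of; exists i.
Qed.

End GraphPartitions.

(** * A partition for the ideal generated by the edges alone *)

Section PlainPartition.
Variables (K : fieldType) (H : sgraph).
Implicit Types (u : {ffun H -> nat}) (F : {set H}).

Definition independent F : bool := [forall x in F, forall y in F, ~~ edge x y].

Lemma plain_exponent_vsupp u : plain_exponent u = independent (vsupp u).
Proof.
apply/plain_exponentP/forall_inP => [h x|h x y exy].
  rewrite inE => /negbTE ux; apply/forall_inP => y; rewrite inE => /negbTE uy.
  by apply/negP => /h [] /eqP; rewrite ?ux ?uy.
have [ux|ux] := eqVneq (u x) 0; [by left|right].
apply/eqP; apply: contraTT exy => uy.
by have := h x; rewrite !inE => /(_ ux) /forall_inP /(_ y); rewrite !inE; apply.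
Qed.

Lemma edge_exponent_vsupp u :
  edge_exponent u = independent (vsupp u) && (vsupp u \subset ~: isolated H).
Proof.
rewrite /edge_exponent plain_exponent_vsupp; congr andb.
apply/forall_inP/subsetP => h x.
  by rewrite !inE; apply: contraNN => xi; apply: h; rewrite inE.
move=> xi; apply: contraTT xi => ux.
by have := h x; rewrite !inE => /(_ ux).
Qed.

Lemma sum_eq_indicator (T : finType) (P : pred T) (s : T) :
  \sum_(F | P F) (s == F : nat) = P s.
Proof.
have [Ps|nPs] := boolP (P s).
  rewrite (bigD1 s) //= eqxx big1 // => F /andP [_ /negbTE].
  by rewrite eq_sym => ->.
rewrite big1 // => F PF; case: eqP => // sF.
by rewrite sF PF in nPs.
Qed.

(** Sort the monomials by support: those of support F form the cone (prod F)
    K[F]. *)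
Lemma edge_support_partition : vpartition (@edge_exponent H)
  (fun F => independent F && (F \subset ~: isolated H)) (fun F => (ones F, F)).
Proof.
move=> u; rewrite edge_exponent_vsupp.
under eq_bigr do rewrite vcone_ones.
exact: (sum_eq_indicator (fun F => independent F && (F \subset ~: isolated H))).
Qed.

Lemma independent_sub F F' : F \subset F' -> independent F' -> independent F.
Proof.
move=> /subsetP FF' /forall_inP h; apply/forall_inP => x /FF' xF.
by apply/forall_inP => y /FF'; move/forall_inP: (h x xF); apply.
Qed.

Lemma independent1 v : independent [set v].
Proof.
apply/forall_inP => x; rewrite inE => /eqP ->; apply/forall_inP => y; rewrite inE => /eqP ->.
by rewrite edge_irr.
Qed.

(** As in the partition by supports, but the constant monomial, whose cone has
    dimension 0, is merged with the cone of the vertex v into K[v]. *)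
Lemma plain_support_partition (v : H) : vpartition (@plain_exponent H)
  (fun F => independent F && (F != set0))
  (fun F => (if F == [set v] then [ffun=> 0] else ones F, F)).
Proof.
move=> u; rewrite plain_exponent_vsupp; set s := vsupp u.
(* The support that labels the block of u. *)
pose s' := if s == set0 then [set v] else s.
have -> : independent s = independent s' && (s' != set0).
  rewrite /s'; case: eqP => [->|/eqP s0]; last by rewrite s0 andbT.
  rewrite independent1 -card_gt0 cards1 /=.
  by apply: independent_sub (independent1 v); rewrite sub0set.
rewrite -(sum_eq_indicator (fun F => independent F && (F != set0))).
apply: eq_bigr => F /andP [_ F0]; congr nat_of_bool.
case: eqP => [->|/eqP Fv].
  rewrite vcone_line subset1 /s' -/s.
  by case: (eqVneq s set0) => _; rewrite ?eqxx ?orbT ?orbF.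
rewrite vcone_ones -/s /s'; case: (eqVneq s set0) => [->|//].
by rewrite (eq_sym set0) (eq_sym [set v]) (negbTE Fv) (negbTE F0).
Qed.

(** Isolated vertices occur in no standard monomial of the edge ideal, and
    freely in those of the plain edge ideal. *)
Lemma plain_partition_of_edge (I : finType) (P : pred I) (c : I -> {ffun H -> nat} * {set H}) :
    vpartition (@edge_exponent H) P c ->
  vpartition (@plain_exponent H) P (fun i => ((c i).1, (c i).2 :|: isolated H)) /\
  forall i, P i -> #|(c i).2 :|: isolated H| = #|(c i).2| + #|isolated H|.
Proof.
move=> part.
have base i x : P i -> x \in isolated H -> (c i).1 x = 0.
  move=> Pi xi; have /andP [_ /forall_inP h] := vpartition_std part Pi (vcone_base _).
  exact/eqP/h.
have disj i x : P i -> x \in isolated H -> x \notin (c i).2.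
  move=> Pi xi; apply/negP => xc.
  have /andP [_ /forall_inP /(_ x xi)] := vpartition_std part Pi (vcone_mono (vcone_base _) xc).
  by rewrite ffunE eqxx addn1.
split=> [u|i Pi].
  pose u0 : {ffun H -> nat} := [ffun x => if x \in isolated H then 0 else u x].
  have -> : plain_exponent u = edge_exponent u0.
    rewrite /edge_exponent.
    have -> : [forall x in isolated H, u0 x == 0].
      by apply/forall_inP => x xi; rewrite ffunE xi.
    have noniso x y : edge x y -> x \in isolated H = false.
      by move=> exy; rewrite inE; apply/negbTE/forallPn; exists y; rewrite negbK.
    rewrite andbT; apply/plain_exponentP/plain_exponentP => h x y exy.
      rewrite !ffunE (noniso x y exy) (noniso y x); [exact: h|by rewrite edge_sym].
    have := h x y exy; rewrite !ffunE (noniso x y exy) (noniso y x) //.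
    by rewrite edge_sym.
  rewrite -part; apply: eq_bigr => i Pi; congr nat_of_bool.
  apply/forallP/forallP => h x; have := h x; rewrite !ffunE /= in_setU.
    case: ifP => [xi _|xi]; first by rewrite base // orbT.
    by rewrite orbF.
  case: ifP => [xi _|xi]; last by rewrite orbF.
  by rewrite base // orbT.
rewrite cardsU (_ : _ :&: _ = set0) ?cards0 ?subn0 //.
apply/setP => x; rewrite in_setI in_set0; apply/negP => /andP [xc xi].
by rewrite (negbTE (disj i x Pi xi)) in xc.
Qed.

(** A partition with t > 0 is needed for the monomials without hubs, whose
    cones only have dimension at least n t.  If the Stanley depth and the
    number of isolated vertices both vanish, the partition by supports
    provides t = 1. *)
Lemma ex_plain_partition : 0 < #|H| ->
  exists (I : finType) (P : pred I) (c : I -> {ffun H -> nat} * {set H}) (t : nat),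
    [/\ vpartition (@plain_exponent H) P c, forall i, P i -> t <= #|(c i).2|,
        0 < t & edge_sdepth K H + #|isolated H| <= t].
Proof.
move=> /card_gt0P [v _].
have [k [c [part le]]] := edge_sdepth_attained K edge_support_partition.
have [part' card'] := plain_partition_of_edge part.
have [t0|t0] := posnP (edge_sdepth K H + #|isolated H|).
  exists {set H}, (fun F => independent F && (F != set0)),
    (fun F => (if F == [set v] then [ffun=> 0] else ones F, F)), 1.
  split; rewrite ?t0 //; first exact: plain_support_partition.
  by move=> F /andP [_]; rewrite -card_gt0.
exists 'I_k, xpredT, (fun i => ((c i).1, (c i).2 :|: isolated H)), (edge_sdepth K H + #|isolated H|).
by split=> // i _; rewrite card' // leq_add2r.
Qed.

End PlainPartition.

(** * Stanley depth of the edge ring of the corona *)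

Section CoronaSdepth.
Variables (K : fieldType) (n : nat) (H : sgraph).
Hypothesis H0 : 0 < #|H|.
Local Notation G := (corona (complete n) H).
Local Notation hub := (@hub n H).
Local Notation leaf := (@leaf n H).
Implicit Types (u : {ffun G -> nat}) (o : option 'I_n).

Definition leaf_part u (j : 'I_n) : {ffun H -> nat} := [ffun h => u (leaf j h)].

Lemma corona_exponentP u : reflect
  [/\ forall i j, i != j -> u (hub i) = 0 \/ u (hub j) = 0,
      forall i h, u (hub i) = 0 \/ u (leaf i h) = 0
    & forall j, plain_exponent (leaf_part u j)]
  (edge_exponent u).
Proof.
have -> : edge_exponent u = plain_exponent u.
  rewrite /edge_exponent andb_idr // => _; rewrite corona_isolated //.
  by apply/forall_inP => x; rewrite inE.
apply: (iffP (plain_exponentP u)) => [h|[h1 h2 h3]].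
  split=> [i j ij|i x|j]; first exact: h.
    by apply: h; rewrite /= eqxx.
  apply/plain_exponentP => x y exy; rewrite !ffunE; apply: h.
  by rewrite /= eqxx.
move=> [i|[i x]] [j|[j y]] /=.
- exact: h1.
- by move/eqP => <-; exact: h2.
- by move/eqP => ->; case: (h2 j x); auto.
- move=> /andP [/eqP <- exy].
  by have := plain_exponentP _ (h3 i) x y exy; rewrite !ffunE.
Qed.

Lemma sum_corona (F : G -> nat) :
  \sum_v F v = \sum_i F (hub i) + \sum_j \sum_h F (leaf j h).
Proof. by rewrite big_sumType /= pair_big; congr addn; apply: eq_bigr => -[]. Qed.

Lemma card_corona_set (A : pred 'I_n) (B : 'I_n -> pred H) (X : {set G}) :
    (forall i, (hub i \in X) = A i) -> (forall j h, (leaf j h \in X) = B j h) ->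
  #|X| = #|A| + \sum_j #|B j|.
Proof.
move=> hA hB; rewrite -sum1_card big_mkcond sum_corona; congr addn.
  by rewrite -sum1_card [RHS]big_mkcond; apply: eq_bigr => i _; rewrite hA.
apply: eq_bigr => j _; rewrite -sum1_card [RHS]big_mkcond; apply: eq_bigr => h _.
by rewrite hB.
Qed.

Section Product.
Variables (I : finType) (P : pred I) (c : I -> {ffun H -> nat} * {set H}).
Hypothesis part : vpartition (@plain_exponent H) P c.
Variables (i0 : I) (t : nat).
Hypotheses (tc : forall i, P i -> t <= #|(c i).2|) (t0 : 0 < t).

(** The first component of x is the hub that occurs, if any; the second one
    selects a cone for each hub, to be used on its leaves. *)
Definition product_cone (x : option 'I_n * {ffun 'I_n -> I}) : {ffun G -> nat} * {set G} :=
  ([ffun v => match v with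
     | inl i => Some i == x.1 : nat
     | inr (j, h) => if Some j == x.1 then 0 else (c (x.2 j)).1 h
     end],
   [set v | match v with
     | inl i => Some i == x.1
     | inr (j, h) => (Some j != x.1) && (h \in (c (x.2 j)).2)
     end]).

(** At the hub that occurs, the selection is fixed to the dummy value i0 to
    avoid repetitions. *)
Definition product_index : pred (option 'I_n * {ffun 'I_n -> I}) := fun x =>
  x.2 \in pfamily i0 (fun j => Some j != x.1) (fun=> P).

Definition selected_hub o u : bool :=
  [forall i, if Some i == o then (0 < u (hub i)) && [forall h, u (leaf i h) == 0]
             else u (hub i) == 0].

Lemma vcone_product o phi u : vcone (product_cone (o, phi)) u =
  selected_hub o u && [forall j, (Some j != o) ==> vcone (c (phi j)) (leaf_part u j)].
Proof.
apply/forallP/andP => [h|[/forallP h1 /forallP h2] [i|[j h]]].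
- split; apply/forallP => i.
    have := h (hub i); rewrite ffunE inE /=; case: (Some i =P o) => [e|_] /=.
      rewrite andbT => ->; apply/forallP => x; have := h (leaf i x).
      by rewrite ffunE inE /= e eqxx.
    by [].
  apply/implyP => io; apply/forallP => x; have := h (leaf i x).
  by rewrite !ffunE !inE /= (negbTE io).
- have := h1 i; rewrite ffunE inE /=; case: (Some i =P o) => _ //=.
  by case/andP => ->.
- have := h1 j; have := h2 j; rewrite ffunE inE /=; case: (Some j =P o) => _ /=.
    by move=> _ /andP [_ /forallP /(_ h)].
  by move=> /forallP /(_ h) + _; rewrite !ffunE.
Qed.

Lemma prod_nat_of_bool (J : finType) (Q b : pred J) :
  \prod_(j | Q j) (b j : nat) = [forall j, Q j ==> b j].
Proof.
have [/forall_inP h|] := boolP [forall j, Q j ==> b j].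
  by rewrite big1 // => j /h ->.
by move=> /forallPn [j]; rewrite negb_imply => /andP [Qj /negbTE bj]; rewrite (bigD1 j) //= bj.
Qed.

Lemma product_partition : vpartition (@edge_exponent G) product_index product_cone.
Proof.
move=> u.
have -> : \sum_(x | product_index x) vcone (product_cone x) u =
    \sum_o \sum_(phi in pfamily i0 (fun j => Some j != o) (fun=> P))
       selected_hub o u * \prod_(j | Some j != o) vcone (c (phi j)) (leaf_part u j).
  rewrite pair_big_dep /=; apply: eq_big => [[o phi]|[o phi] _] //=.
  by rewrite vcone_product prod_nat_of_bool mulnb.
pose plain j := plain_exponent (leaf_part u j).
have -> : \sum_o \sum_(phi in pfamily i0 (fun j => Some j != o) (fun=> P))
       selected_hub o u * \prod_(j | Some j != o) vcone (c (phi j)) (leaf_part u j) =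
    \sum_o (selected_hub o u && [forall j, (Some j != o) ==> plain j]).
  apply: eq_bigr => o _; rewrite -big_distrr /=.
  rewrite -(big_distr_big_dep i0 (fun j => Some j != o) (fun=> P)
    (fun j i => vcone (c i) (leaf_part u j) : nat)) -mulnb -prod_nat_of_bool.
  by congr muln; apply: eq_bigr => j _; rewrite part.
have [[i hi]|noh] := pselect (exists i, 0 < u (hub i)).
  rewrite (bigD1 (Some i)) //= big1 => [|[j|] ne].
  - rewrite addn0; congr nat_of_bool; apply/andP/corona_exponentP.
      move=> [/forallP sel /forallP pl]; split=> [j k jk|j h|j].
      + have := sel j; case: eqP => [[ji]|_ /eqP]; last by left.
        have := sel k; case: eqP => [[ki]|_ /eqP]; last by right.
        by rewrite ji ki eqxx in jk.
      + have := sel j; case: eqP => [[ji]|_ /eqP]; last by left.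
        by move=> /andP [_ /forallP /(_ h) /eqP]; right.
      + have [ji|ji] := eqVneq j i; last by have := pl j; rewrite (_ : Some j != Some i).
        apply/plain_exponentP => x y _; left; rewrite ffunE.
        by have := sel j; rewrite ji eqxx => /andP [_ /forallP /(_ x) /eqP].
    move=> [h1 h2 h3]; split; apply/forallP => j; last by apply/implyP => _; exact: h3.
    case: eqP => [[->]|ne].
      rewrite hi; apply/forallP => h; case: (h2 i h) => [e|->] //.
      by rewrite e in hi.
    have ij : i != j by apply/eqP => e; apply: ne; rewrite e.
    by case: (h1 i j ij) => [e|->] //; rewrite e in hi.
  - rewrite (_ : selected_hub _ _ = false) //; apply/negbTE/forallPn; exists i.
    by rewrite eq_sym (negbTE ne) -lt0n.
  - rewrite (_ : selected_hub _ _ = false) //; apply/negbTE/forallPn; exists i.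
    by rewrite -lt0n.
have noh0 i : u (hub i) = 0.
  by apply/eqP; rewrite -leqn0 leqNgt; apply/negP => hi; apply: noh; exists i.
rewrite (bigD1 None) //= big1 => [|[j|] //= _]; last first.
  rewrite (_ : selected_hub _ _ = false) //; apply/negbTE/forallPn; exists j.
  by rewrite eqxx noh0.
rewrite addn0; congr nat_of_bool; apply/andP/corona_exponentP.
  by move=> [_ /forallP pl]; split=> [i j _|i h|j]; [left|left|exact: pl].
move=> [_ _ h3]; split; apply/forallP => j; first by rewrite /= noh0.
exact: h3.
Qed.

Lemma card_product_cone x : 1 <= n -> product_index x ->
  1 + (n - 1) * t <= #|(product_cone x).2|.
Proof.
case: x => o phi n1 /pfamilyP [_ /= Pphi].
rewrite (@card_corona_set (fun i => Some i == o)
  (fun j h => (Some j != o) && (h \in (c (phi j)).2))); last 2 first.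
- by move=> i; rewrite inE.
- by move=> j h; rewrite inE.
have le : \sum_(j | Some j != o) t <= \sum_j #|[pred h | (Some j != o) && (h \in (c (phi j)).2)]|.
  rewrite [leqLHS]big_mkcond; apply: leq_sum => j _; case: ifP => // jo.
  apply: leq_trans (tc (Pphi j jo)) _; apply/subset_leq_card/subsetP => h hc.
  by rewrite !inE; apply/andP.
case: o Pphi le => [i|] Pphi le.
  have -> : #|[pred j | Some j == Some i]| = 1.
    by rewrite -(card1 i); apply: eq_card => j; rewrite !inE.
  rewrite leq_add2l; apply: leq_trans le.
  rewrite sum_nat_const (eq_card (B := predC1 i)) ?cardC1 ?card_ord ?subn1 //.
rewrite eq_card0 ?add0n; last by move=> j; rewrite inE.
apply: leq_trans le; rewrite sum_nat_const (eq_card (B := 'I_n)) ?card_ord //.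
rewrite -{2}(subnK n1) mulnDl mul1n addnC leq_add2l //.
Qed.

End Product.

Lemma corona_sdepth_ge : 1 <= n ->
  1 + (n - 1) * (edge_sdepth K H + #|isolated H|) <= edge_sdepth K G.
Proof.
move=> n1; have [I [P [c [t [part tc t0 le]]]]] := ex_plain_partition K H0.
have [i0 Pi0] : exists i, P i.
  apply: contrapT => nP; have P0 : P =1 xpred0.
    by move=> i; apply/negP => Pi; apply: nP; exists i.
  have := part [ffun=> 0]; rewrite (big_pred0 _ _ _ _ P0).
  by rewrite (introT (plain_exponentP _)) // => x y _; rewrite ffunE; left.
apply: (@leq_trans (1 + (n - 1) * t)); last first.
  apply: (edge_sdepth_ge K (product_partition part i0)) => x.
  exact: (card_product_cone tc t0 n1).
by rewrite leq_add2l leq_mul2l le orbT.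
Qed.

(** In the cone that contains the hub z, multiplying z by a free variable
    gives a standard monomial, which excludes the other hubs and the leaves at
    z. *)
Lemma corona_sdepth_le : 1 <= n -> edge_sdepth K G <= 1 + (n - 1) * #|H|.
Proof.
move=> n1; apply: edge_sdepth_le => k c part; pose z : 'I_n := Ordinal n1.
pose u : {ffun G -> nat} := ones [set hub z].
have su : edge_exponent u.
  rewrite edge_exponent_vsupp corona_isolated // setC0 subsetT andbT.
  rewrite (_ : vsupp u = [set hub z]) ?independent1 //.
  by apply/setP => v; rewrite !inE ffunE inE; case: (v == _).
have [i ci] : exists i, vcone (c i) u.
  apply: contrapT => nc; have := part u; rewrite su big1 // => i _.
  by apply/eqP; rewrite eqb0; apply/negP => ci; apply: nc; exists i.
exists i; pose B := [set v : G | match v with inl j => j == z | inr (j, _) => j != z end].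
apply: (@leq_trans #|B|).
  apply/subset_leq_card/subsetP => v vc.
  have := vpartition_std part isT (vcone_mono ci vc).
  move=> /corona_exponentP [h1 h2 _]; rewrite inE.
  have uz w : [ffun x => u x + (x == w)] (hub z) <> 0.
    by rewrite !ffunE inE eqxx.
  case: v vc h1 h2 => [j|[j h]] vc h1 h2.
    apply: contrapT => /negP jz; case: (h1 _ _ jz) => [|/uz //].
    by rewrite !ffunE eqxx addn1.
  apply/eqP => jz; subst j; case: (h2 z h) => [/uz //|].
  by rewrite !ffunE eqxx addn1.
rewrite (@card_corona_set (pred1 z) (fun j _ => j != z)); last 2 first.
- by move=> j; rewrite inE.
- by move=> j h; rewrite inE.
rewrite card1 leq_add2l (eq_bigr (fun j => if j != z then #|H| else 0)) => [|j _].
  by rewrite -big_mkcond sum_nat_const cardC1 card_ord subn1.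
by case: (j != z); [apply: eq_card|apply: eq_card0].
Qed.

End CoronaSdepth.

Theorem theorem2p13 (K : fieldType) (n : nat) (H : sgraph)
    (hn : 1 <= n) (hH : 0 < #|H|) :
  [/\ edge_depth K (corona (complete n) H)
        = 1 + (n - 1) * (edge_depth K H + #|isolated H|),
      edge_sdepth K (corona (complete n) H)
        >= 1 + (n - 1) * (edge_sdepth K H + #|isolated H|)
    & null_graph H ->
      edge_sdepth K (corona (complete n) H) = 1 + (n - 1) * #|H|].
Proof.
split; [exact: corona_depth|exact: corona_sdepth_ge|move=> nullH].
have isoH : #|isolated H| = #|H|.
  by apply: eq_card => x; rewrite !inE; apply/forallP => y; exact: nullH.
apply/eqP; rewrite eqn_leq corona_sdepth_le //=.
apply: leq_trans (corona_sdepth_ge K hH hn).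
by rewrite leq_add2l leq_mul2l isoH leq_addl orbT.
Qed.
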